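(* In the ring $K_0(\mathcal V_{\mathbb C})[[x]]$, the exponential generating series $$\pi(x)=1+\sum_{n=1}^\infty [X_\Pi^{n-1}]\frac{x^n}{n!},\qquad \tau(x)=1-\sum_{n=1}^\infty [\mathbb T_{\mathbb C}^{n-1}]\frac{x^n}{n!}$$ are multiplicatively inverse to each other: $\pi(x)\tau(x)=1$.
   Context: $K_0(\mathcal V_{\mathbb C})$ is the Grothendieck ring of complex quasi-projective varieties: generated by isomorphism classes $[X]$ modulo $[X]=[Y]+[X\setminus Y]$ for $Y\subset X$ Zariski locally closed, with product $[X][Y]=[X\times Y]$. $\mathbb T_{\mathbb C}^m=(\mathbb C^* )^m$ is the algebraic torus ($\mathbb T^0_{\mathbb C}$ a point). The permutohedral variety $X_\Pi^m$ is the smooth projective toric variety corresponding to the $m$-dimensional permutohedron (the convex hull of all permutations of $(1,2,\dots,m+1)$); $X_\Pi^0$ is a point, $X_\Pi^1=\mathbb CP^1$. *)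

(* Defs.v *)
From HB Require Import structures.
From mathcomp Require Import all_fingroup all_boot all_order all_algebra.
From mathcomp Require Import boolp classical_sets reals.
From mathcomp Require Import mpoly complex generic_quotient.

Set Implicit Arguments.
Unset Strict Implicit.
Unset Printing Implicit Defensive.

Import GRing.Theory.
Local Open Scope ring_scope.
Local Open Scope classical_set_scope.
Local Open Scope quotient_scope.

Section Projective.
Variable k : fieldType.

(* Lines of k^N: this is P^(N-1)(k), and it is empty for N = 0. *)
Definition pspace (N : nat) := {L : {vspace 'rV[k]_N} | \dim L == 1%N}.

(* x is a vector of homogeneous coordinates of L (in particular x != 0). *)
Definition hcoord N (L : pspace N) (x : 'rV[k]_N) := val L = <[x]>%VS.

Definition vanishes N (f : {mpoly k[N]}) (L : pspace N) :=
  forall x, hcoord L x -> f.@[x 0] = 0.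

Definition homogeneous N (f : {mpoly k[N]}) := exists d, f \is d.-homog.

Definition zeros N (F : set {mpoly k[N]}) : set (pspace N) :=
  [set L | forall f, F f -> vanishes f L].

Definition zclosed N (Z : set (pspace N)) :=
  exists F : set {mpoly k[N]}, F `<=` @homogeneous N /\ Z = zeros F.

Definition zopen N (U : set (pspace N)) := zclosed (~` U).

Definition zclosure N (S : set (pspace N)) : set (pspace N) :=
  zeros [set f | homogeneous f /\ forall L, S L -> vanishes f L].

Definition locally_closed N (X : set (pspace N)) :=
  exists U Z, [/\ zopen U, zclosed Z & X = U `&` Z].

(* A quasi-projective variety in the projective space of dimension
   qpcoords - 1, given by its points; it may be reducible. *)
Record qpvar := QPVar {
  qpcoords : nat;
  qpset : set (pspace qpcoords);
  qpsetP : locally_closed qpset }.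
Arguments qpset : clear implicits.

Definition qppoints (X : qpvar) := {p | qpset X p}.

(* Near every point, f is given by homogeneous polynomials of the same degree;
   they have no common zero there, since hcoord excludes the zero vector. *)
Definition regular (X Y : qpvar) (f : qppoints X -> qppoints Y) :=
  forall p : qppoints X, exists U d (F : 'I_(qpcoords Y) -> {mpoly k[qpcoords X]}),
    [/\ zopen U, U (sval p), forall i, F i \is d.-homog &
        forall (q : qppoints X) x, U (sval q) -> hcoord (sval q) x ->
          hcoord (sval (f q)) (\row_i (F i).@[x 0])].

Definition qpiso (X Y : qpvar) :=
  exists (f : qppoints X -> qppoints Y) (g : qppoints Y -> qppoints X),
    [/\ regular f, regular g, cancel f g & cancel g f].

(* The Segre embedding sends ([x], [y]) to the line of the matrix x^T y. *)
Definition segre_image N M (X : set (pspace N)) (Y : set (pspace M)) :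
    set (pspace (N * M)) :=
  [set L | exists P Q x y, [/\ X P, Y Q, hcoord P x, hcoord Q y &
                               hcoord L (mxvec (x^T *m y))]].

(* The points [1 : t_1 : ... : t_m] with all t_i nonzero. *)
Definition torus_set (m : nat) : set (pspace (1 + m)) :=
  [set L | exists t : 'rV[k]_m,
     (forall i, t 0 i != 0) /\ hcoord L (row_mx (1 : 'rV[k]_1) t)].

(* The image of (k^* )^n under the monomials t^a, a \in A. *)
Definition monomial_image n b (A : {set {ffun 'I_n -> 'I_b}}) :
    set (pspace #|A|) :=
  [set L | exists t : 'I_n -> k,
     (forall i, t i != 0) /\
     hcoord L (\row_(j < #|A|) \prod_i t i ^+ (enum_val j i))].

Arguments torus_set : clear implicits.
Arguments monomial_image {n b} A.

(******************************************************************************)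

Lemma hcoord_exists N (L : pspace N) : exists2 x, x != 0 & hcoord L x.
Proof.
case: L => L dL; exists (vpick L).
  by rewrite vpick0 -dimv_eq0 (eqP dL).
rewrite /hcoord /=; apply/esym/eqP; rewrite eqEdim -memvE memv_pick /=.
by rewrite (eqP dL) dim_vline vpick0 -dimv_eq0 (eqP dL).
Qed.

Lemma hcoord_neq0 N (L : pspace N) x : hcoord L x -> x != 0.
Proof.
rewrite /hcoord => Lx; have := valP L.
by rewrite -/(val L) Lx dim_vline; case: (x == 0).
Qed.

Lemma hcoord_scale N (L : pspace N) x y :
  hcoord L x -> hcoord L y -> exists2 c, c != 0 & y = c *: x.
Proof.
move=> Lx Ly; have : y \in <[x]>%VS by rewrite -Lx Ly memv_line.
case/vlineP=> c yE; exists c => //; apply/eqP => c0.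
by have := hcoord_neq0 Ly; rewrite yE c0 scale0r eqxx.
Qed.

Lemma pspace_of N (x : 'rV[k]_N) : x != 0 -> exists L : pspace N, hcoord L x.
Proof.
move=> x0; have dx : \dim <[x]>%VS == 1%N by rewrite dim_vline x0.
by exists (exist _ <[x]>%VS dx).
Qed.

Lemma homog_meval N d (f : {mpoly k[N]}) c (v : 'I_N -> k) :
  f \is d.-homog -> f.@[fun i => c * v i] = c ^+ d * f.@[v].
Proof.
move=> /dhomogP hf; rewrite !mevalE big_distrr /= big_seq [RHS]big_seq.
apply: eq_bigr => m mf; rewrite mulrCA; congr (_ * _).
rewrite -(hf m mf) /= mdegE -prodrXr -big_split /=.
by apply: eq_bigr => i _; rewrite exprMn.
Qed.

Lemma vanishesE N (f : {mpoly k[N]}) (L : pspace N) x :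
  homogeneous f -> hcoord L x -> vanishes f L <-> f.@[x 0] = 0.
Proof.
move=> [d hf] Lx; split=> [|f0 y Ly]; first exact.
have [c _ ->] := hcoord_scale Lx Ly.
rewrite (@meval_eq _ _ _ (fun i => c * x 0 i)) => [|i]; last by rewrite mxE.
by rewrite (homog_meval _ _ hf) f0 mulr0.
Qed.

Lemma zeros_closed N (F : set {mpoly k[N]}) :
  F `<=` @homogeneous N -> zclosed (zeros F).
Proof. by move=> hF; exists F. Qed.

Lemma zclosedI N (Y Z : set (pspace N)) :
  zclosed Y -> zclosed Z -> zclosed (Y `&` Z).
Proof.
move=> [F [hF ->]] [G [hG ->]]; exists (F `|` G); split.
  by move=> f [/hF|/hG].
apply/seteqP; split=> L.
  by move=> [FL GL] f [/FL|/GL].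
by move=> FG; split=> f ff; apply: FG; [left|right].
Qed.

Lemma zclosedU N (Y Z : set (pspace N)) :
  zclosed Y -> zclosed Z -> zclosed (Y `|` Z).
Proof.
move=> [F [hF ->]] [G [hG ->]].
pose H := [set h | exists f g, [/\ F f, G g & h = f * g :> {mpoly k[N]}]].
have hH : H `<=` @homogeneous N.
  move=> _ [f [g [/hF[d hf] /hG[e hg] ->]]]; exists (d + e)%N.
  exact: dhomogM.
exists H; split=> //; apply/seteqP; split=> L.
  move=> [FL|GL] _ [f [g [Ff Gg ->]]] x Lx; rewrite mevalM.
    by rewrite (FL f Ff x Lx) mul0r.
  by rewrite (GL g Gg x Lx) mulr0.
move=> HL; have [x x0 Lx] := hcoord_exists L.
have [FL|] := pselect (zeros F L); first by left.
move=> /existsNP[f /not_implyP[Ff nf]]; right=> g Gg.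
apply/(vanishesE (hG g Gg) Lx).
have /eqP := HL (f * g) (ex_intro _ f (ex_intro _ g (And3 Ff Gg erefl))) x Lx.
rewrite mevalM mulf_eq0 => /orP[/eqP f0|/eqP //].
by case: nf; apply/(vanishesE (hF f Ff) Lx).
Qed.

Lemma zclosedT N : zclosed [set: pspace N].
Proof.
by exists set0; split=> [f []|]; apply/seteqP; split=> [L _ f []|L _].
Qed.

Lemma zopenC N (Z : set (pspace N)) : zclosed Z -> zopen (~` Z).
Proof. by rewrite /zopen setCK. Qed.

Lemma zopenI N (U V : set (pspace N)) : zopen U -> zopen V -> zopen (U `&` V).
Proof. by rewrite /zopen setCI; exact: zclosedU. Qed.

Lemma zopenT N : zopen [set: pspace N].
Proof.
rewrite /zopen setCT; exists [set 1]; split.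
  by move=> _ ->; exists 0%N; exact: dhomog1.
apply/seteqP; split=> // L /(_ 1 erefl).
have [x _ Lx] := hcoord_exists L.
by move=> /(_ x Lx)/eqP; rewrite meval1 oner_eq0.
Qed.

Lemma zclosed_lc N (Z : set (pspace N)) : zclosed Z -> locally_closed Z.
Proof.
by move=> cZ; exists setT, Z; split=> //; [exact: zopenT|rewrite setTI].
Qed.

Lemma zopen_lc N (U : set (pspace N)) : zopen U -> locally_closed U.
Proof.
by move=> oU; exists U, setT; split=> //; [exact: zclosedT|rewrite setIT].
Qed.

Lemma zclosure_closed N (S : set (pspace N)) : zclosed (zclosure S).
Proof. by apply: zeros_closed => f []. Qed.

Lemma homog_prodX N M (h : 'I_N -> 'I_M) (m : 'X_{1..N}) :
  'X_[m] \mPo [tuple 'X_(h i) | i < N] \is [in k[M], (mdeg m).-homog].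
Proof.
rewrite comp_mpolyX mdegE; apply: (big_rec2 (fun d (p : {mpoly k[M]}) =>
  p \is d.-homog)) => [|i d p _ hp]; first exact: dhomog1.
apply: dhomogM => //; rewrite tnth_mktuple -[X in X.-homog]mul1n.
by apply: dhomogMn; rewrite dhomogX /= mdeg1.
Qed.

Lemma homog_comp N M (h : 'I_N -> 'I_M) d (f : {mpoly k[N]}) :
  f \is d.-homog -> f \mPo [tuple 'X_(h i) | i < N] \is [in k[M], d.-homog].
Proof.
move=> /dhomogP hf; rewrite comp_mpolyEX big_seq rpred_sum // => m mf.
by rewrite rpredZ // -(hf m mf); exact: homog_prodX.
Qed.

Lemma meval_comp N M (h : 'I_N -> 'I_M) (f : {mpoly k[N]}) v :
  (f \mPo [tuple 'X_(h i) | i < N]).@[v] = f.@[fun i => v (h i)].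
Proof.
by rewrite comp_mpoly_meval; apply: meval_eq => i;
  rewrite tnth_mktuple mevalXU.
Qed.

Lemma segre_lc N M (X : set (pspace N)) (Y : set (pspace M)) :
  locally_closed X -> locally_closed Y -> locally_closed (segre_image X Y).
Proof.
pose col (F : set {mpoly k[N]}) : set {mpoly k[N * M]} :=
  [set g | exists f j, F f /\ g = f \mPo [tuple 'X_(mxvec_index i j) | i < N]].
pose row (F : set {mpoly k[M]}) : set {mpoly k[N * M]} :=
  [set g | exists f i, F f /\ g = f \mPo [tuple 'X_(mxvec_index i j) | j < M]].
pose X_ i j : {mpoly k[N * M]} := 'X_(mxvec_index i j).
pose minors : set {mpoly k[N * M]} :=
  [set g | exists i i' j j', g = X_ i j * X_ i' j' - X_ i j' * X_ i' j].
have colh F : F `<=` @homogeneous N -> col F `<=` @homogeneous _.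
  move=> hF _ [f [j [/hF[d hf] ->]]]; exists d; exact: homog_comp.
have rowh F : F `<=` @homogeneous M -> row F `<=` @homogeneous _.
  move=> hF _ [f [j [/hF[d hf] ->]]]; exists d; exact: homog_comp.
have minh : minors `<=` @homogeneous _.
  move=> _ [i [i' [j [j' ->]]]]; exists (1 + 1)%N.
  by rewrite rpredB // dhomogM // dhomogX /= mdeg1.
have colZ F L (P : pspace N) (Q : pspace M) x y :
    F `<=` @homogeneous N -> hcoord P x -> hcoord Q y ->
    hcoord L (mxvec (x^T *m y)) -> zeros (col F) L <-> zeros F P.
  move=> hF Px Qy Lz; split=> [H f Ff|H _ [f [j [Ff ->]]]].
    have /rV0Pn[j yj] := hcoord_neq0 Qy.
    apply/(vanishesE (hF f Ff) Px); have [d hf] := hF f Ff.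
    have := H _ (ex_intro _ f (ex_intro _ j (conj Ff erefl))) _ Lz.
    rewrite meval_comp (@meval_eq _ _ _ (fun i => y 0 j * x 0 i)).
      rewrite (homog_meval _ _ hf) => /eqP; rewrite mulf_eq0 expf_eq0.
      by rewrite (negPf yj) andbF => /eqP.
    by move=> i; rewrite mxvecE mxE big_ord1 !mxE mulrC.
  have [d hf] := hF f Ff.
  have hg : homogeneous (f \mPo [tuple 'X_(mxvec_index i j) | i < N]).
    by exists d; exact: homog_comp.
  apply/(vanishesE hg Lz).
  rewrite meval_comp (@meval_eq _ _ _ (fun i => y 0 j * x 0 i)).
    by rewrite (homog_meval _ _ hf) (H f Ff x Px) mulr0.
  by move=> i; rewrite mxvecE mxE big_ord1 !mxE mulrC.
have rowZ F L (P : pspace N) (Q : pspace M) x y :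
    F `<=` @homogeneous M -> hcoord P x -> hcoord Q y ->
    hcoord L (mxvec (x^T *m y)) -> zeros (row F) L <-> zeros F Q.
  move=> hF Px Qy Lz; split=> [H f Ff|H _ [f [i [Ff ->]]]].
    have /rV0Pn[i xi] := hcoord_neq0 Px.
    apply/(vanishesE (hF f Ff) Qy); have [d hf] := hF f Ff.
    have := H _ (ex_intro _ f (ex_intro _ i (conj Ff erefl))) _ Lz.
    rewrite meval_comp (@meval_eq _ _ _ (fun j => x 0 i * y 0 j)).
      rewrite (homog_meval _ _ hf) => /eqP; rewrite mulf_eq0 expf_eq0.
      by rewrite (negPf xi) andbF => /eqP.
    by move=> j; rewrite mxvecE mxE big_ord1 !mxE.
  have [d hf] := hF f Ff.
  have hg : homogeneous (f \mPo [tuple 'X_(mxvec_index i j) | j < M]).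
    by exists d; exact: homog_comp.
  apply/(vanishesE hg Lz).
  rewrite meval_comp (@meval_eq _ _ _ (fun j => x 0 i * y 0 j)).
    by rewrite (homog_meval _ _ hf) (H f Ff y Qy) mulr0.
  by move=> j; rewrite mxvecE mxE big_ord1 !mxE.
have minP L : zeros minors L <-> exists (P : pspace N) (Q : pspace M) x y,
    [/\ hcoord P x, hcoord Q y & hcoord L (mxvec (x^T *m y))].
  split=> [H|[P [Q [x [y [Px Qy Lz]]]]]].
    have [z z0 Lz] := hcoord_exists L.
    have mz i i' j j' : z 0 (mxvec_index i j) * z 0 (mxvec_index i' j') =
                        z 0 (mxvec_index i j') * z 0 (mxvec_index i' j).
      have := H (X_ i j * X_ i' j' - X_ i j' * X_ i' j)
        (ex_intro _ i (ex_intro _ i' (ex_intro _ j (ex_intro _ j' erefl))))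
        z Lz.
      by rewrite mevalB !mevalM !mevalXU => /eqP; rewrite subr_eq0 => /eqP.
    have /rV0Pn[ij] := z0; case/mxvec_indexP: ij => i0 j0 zn0.
    pose x : 'rV[k]_N := \row_i z 0 (mxvec_index i j0).
    pose y : 'rV[k]_M := \row_j (z 0 (mxvec_index i0 j) /
                                 z 0 (mxvec_index i0 j0)).
    have [P Px] : exists P : pspace N, hcoord P x.
      by apply: pspace_of; apply/rV0Pn; exists i0; rewrite mxE.
    have [Q Qy] : exists Q : pspace M, hcoord Q y.
      apply: pspace_of; apply/rV0Pn; exists j0.
      by rewrite mxE divff ?oner_eq0.
    exists P, Q, x, y; split=> //; suff -> : mxvec (x^T *m y) = z by [].
    apply/rowP => ij; case/mxvec_indexP: ij => i j.
    rewrite mxvecE mxE big_ord1 !mxE mulrA mz mulfK //.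
  move=> _ [i [i' [j [j' ->]]]].
  apply/(vanishesE _ Lz); first by apply: minh; exists i, i', j, j'.
  rewrite mevalB !mevalM !mevalXU !mxvecE !mxE !big_ord1 !mxE.
  by apply/eqP; rewrite subr_eq0; apply/eqP; rewrite mulrACA [y 0 j * _]mulrC mulrACA.
move=> [U1 [_ [[G1 [hG1 U1E]] [F1 [hF1 ->]] ->]]].
move=> [U2 [_ [[G2 [hG2 U2E]] [F2 [hF2 ->]] ->]]].
have {U1E} -> : U1 = ~` zeros G1 by rewrite -U1E setCK.
have {U2E} -> : U2 = ~` zeros G2 by rewrite -U2E setCK.
exists (~` zeros (col G1) `&` ~` zeros (row G2)),
  (zeros (col F1) `&` zeros (row F2) `&` zeros minors); split.
- by apply: zopenI; apply: zopenC; apply: zeros_closed; [exact: colh|exact: rowh].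
- by apply: zclosedI; [apply: zclosedI|]; apply: zeros_closed;
    [exact: colh|exact: rowh|].
apply/seteqP; split=> L.
  move=> [P [Q [x [y [[XP1 XP2] [YQ1 YQ2] Px Qy Lz]]]]].
  split; split.
  - by move/(colZ _ _ _ _ _ _ hG1 Px Qy Lz).
  - by move/(rowZ _ _ _ _ _ _ hG2 Px Qy Lz).
  - by split; [apply/(colZ _ _ _ _ _ _ hF1 Px Qy Lz)
              |apply/(rowZ _ _ _ _ _ _ hF2 Px Qy Lz)].
  - by apply/minP; exists P, Q, x, y.
move=> [[nG1 nG2] [[cF1 rF2] /minP[P [Q [x [y [Px Qy Lz]]]]]]].
exists P, Q, x, y; split=> //; split.
- by move=> g; apply: nG1; apply/(colZ _ _ _ _ _ _ hG1 Px Qy Lz).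
- by apply/(colZ _ _ _ _ _ _ hF1 Px Qy Lz).
- by move=> g; apply: nG2; apply/(rowZ _ _ _ _ _ _ hG2 Px Qy Lz).
- by apply/(rowZ _ _ _ _ _ _ hF2 Px Qy Lz).
Qed.

Lemma torus_lc m : locally_closed (torus_set m).
Proof.
pose g : {mpoly k[1 + m]} := \prod_(i < 1 + m) 'X_i.
have hg : homogeneous g.
  exists (\sum_(i < 1 + m) 1)%N.
  apply: (big_rec2 (fun d (p : {mpoly k[1 + m]}) => p \is d.-homog)).
    exact: dhomog1.
  by move=> i d p _ hp; apply: dhomogM => //; rewrite dhomogX /= mdeg1.
have gE v : g.@[v] = \prod_i v i.
  by rewrite /g rmorph_prod; apply: eq_bigr => i _; rewrite /= mevalXU.
apply: zopen_lc; exists [set g]; split=> [_ -> //|].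
apply/seteqP; split=> L.
  move=> nT _ ->; have [x x0 Lx] := hcoord_exists L.
  apply/(vanishesE hg Lx); rewrite gE; apply/eqP/negPn/negP => /prodf_neq0 xn.
  have x00 : x 0 (lshift m 0) != 0 by exact: xn.
  apply: nT; exists (rsubmx ((x 0 (lshift m 0))^-1 *: x)); split.
    by move=> i; rewrite !mxE mulf_neq0 ?invr_eq0 //; exact: xn.
  set c := (x 0 (lshift m 0))^-1.
  have -> : row_mx 1 (rsubmx (c *: x)) = c *: x.
    rewrite -[RHS]hsubmxK; congr row_mx; apply/rowP => i.
    by rewrite !mxE !ord1 mulVf.
  rewrite /hcoord Lx; apply/esym/eqP; rewrite eqEdim -memvE memvZ ?memv_line //=.
  by rewrite !dim_vline scaler_eq0 invr_eq0 negb_or x0 x00.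
move=> H [t [tn Lt]]; have := H g erefl _ Lt; rewrite gE => /eqP.
apply/negP/prodf_neq0 => i _; rewrite mxE; case: split => j.
  by rewrite !ord1 mxE oner_eq0.
exact: tn.
Qed.

Definition qpprod (X Y : qpvar) := QPVar (segre_lc (qpsetP X) (qpsetP Y)).

Definition torus m := QPVar (torus_lc m).

(* The projective toric variety X_A of a finite set A of characters. *)
Definition toric_variety n b (A : {set {ffun 'I_n -> 'I_b}}) :=
  QPVar (zclosed_lc (zclosure_closed (monomial_image A))).

End Projective.

Arguments qpset {k} q : rename.
Arguments torus_set k m : clear implicits.
Arguments monomial_image {k n b} A.
Arguments toric_variety k {n b} A.

Section Grothendieck.
Variable k : closedFieldType.

(* The Grothendieck ring is the commutative ring presented by one generator
   per quasi-projective variety and the relations below. *)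
Inductive K0term :=
| K0gen of qpvar k | K0zero | K0one
| K0opp of K0term | K0add of K0term & K0term | K0mul of K0term & K0term.

Inductive K0rel : K0term -> K0term -> Prop :=
| K0refl a : K0rel a a
| K0sym a b : K0rel a b -> K0rel b a
| K0trans b a c : K0rel a b -> K0rel b c -> K0rel a c
| K0oppC a b : K0rel a b -> K0rel (K0opp a) (K0opp b)
| K0addC a b c d : K0rel a b -> K0rel c d -> K0rel (K0add a c) (K0add b d)
| K0mulC a b c d : K0rel a b -> K0rel c d -> K0rel (K0mul a c) (K0mul b d)
| K0addrA a b c : K0rel (K0add a (K0add b c)) (K0add (K0add a b) c)
| K0addrC a b : K0rel (K0add a b) (K0add b a)
| K0add0r a : K0rel (K0add K0zero a) a
| K0addNr a : K0rel (K0add (K0opp a) a) K0zero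
| K0mulrA a b c : K0rel (K0mul a (K0mul b c)) (K0mul (K0mul a b) c)
| K0mulrC a b : K0rel (K0mul a b) (K0mul b a)
| K0mul1r a : K0rel (K0mul K0one a) a
| K0mulrDl a b c :
    K0rel (K0mul (K0add a b) c) (K0add (K0mul a c) (K0mul b c))
| K0iso X Y : qpiso X Y -> K0rel (K0gen X) (K0gen Y)
(* For Y locally closed in X, X \ Y need not be locally closed: the relation
   is imposed whenever it is, in particular for all closed and all open Y. *)
| K0scissor N (X Y : set (pspace k N)) (lcX : locally_closed X)
    (lcY : locally_closed Y) (lcD : locally_closed (X `\` Y)) : Y `<=` X ->
    K0rel (K0gen (QPVar lcX)) (K0add (K0gen (QPVar lcY)) (K0gen (QPVar lcD)))
| K0prod X Y : K0rel (K0mul (K0gen X) (K0gen Y)) (K0gen (qpprod X Y))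
(* As [X] [pt] = [X], the unit of the ring is the class of a point. *)
| K0point X : (exists p, qpset X = [set p]) -> K0rel (K0gen X) K0one.

HB.instance Definition _ := gen_eqMixin K0term.
HB.instance Definition _ := gen_choiceMixin K0term.

Definition K0relb (a b : K0term) := `[< K0rel a b >].

Lemma K0relb_refl : reflexive K0relb.
Proof. by move=> a; apply/asboolP; exact: K0refl. Qed.

Lemma K0relb_sym : ssrbool.symmetric K0relb.
Proof. by move=> a b; apply/asboolP/asboolP; exact: K0sym. Qed.

Lemma K0relb_trans : transitive K0relb.
Proof.
by move=> b a c /asboolP ab /asboolP bc; apply/asboolP; exact: K0trans bc.
Qed.

Canonical K0relb_equiv := EquivRel K0relb K0relb_refl K0relb_sym K0relb_trans.

Definition K0 := {eq_quot K0relb}.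

HB.instance Definition _ := Choice.on K0.

Lemma K0_eq a b : K0rel a b -> \pi_K0 a = \pi_K0 b.
Proof. by move=> ab; apply/eqmodP/asboolP. Qed.

Lemma K0_repr a : K0rel (repr (\pi_K0 a)) a.
Proof. by apply/asboolP; apply/(eqmodP K0relb_equiv); rewrite reprK. Qed.

Lemma K0_surj (u : K0) : exists a, u = \pi_K0 a.
Proof. by exists (repr u); rewrite reprK. Qed.

Definition K0_opp (u : K0) : K0 := \pi_K0 (K0opp (repr u)).
Definition K0_add (u v : K0) : K0 := \pi_K0 (K0add (repr u) (repr v)).
Definition K0_mul (u v : K0) : K0 := \pi_K0 (K0mul (repr u) (repr v)).

Lemma K0_oppE a : K0_opp (\pi_K0 a) = \pi_K0 (K0opp a).
Proof. by apply: K0_eq; apply: K0oppC; exact: K0_repr. Qed.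

Lemma K0_addE a b : K0_add (\pi_K0 a) (\pi_K0 b) = \pi_K0 (K0add a b).
Proof. by apply: K0_eq; apply: K0addC; exact: K0_repr. Qed.

Lemma K0_mulE a b : K0_mul (\pi_K0 a) (\pi_K0 b) = \pi_K0 (K0mul a b).
Proof. by apply: K0_eq; apply: K0mulC; exact: K0_repr. Qed.

Lemma K0_addA : associative K0_add.
Proof.
move=> u v w; have [[a ->] [b ->]] := (K0_surj u, K0_surj v).
have [c ->] := K0_surj w.
rewrite !K0_addE.
by apply: K0_eq; exact: K0addrA.
Qed.

Lemma K0_addC : commutative K0_add.
Proof. by move=> u v; apply: K0_eq; exact: K0addrC. Qed.

Lemma K0_add0 : left_id (\pi_K0 K0zero) K0_add.
Proof.
by move=> u; have [a ->] := K0_surj u; rewrite K0_addE; apply: K0_eq; exact: K0add0r.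
Qed.

Lemma K0_addN : left_inverse (\pi_K0 K0zero) K0_opp K0_add.
Proof.
move=> u; have [a ->] := K0_surj u; rewrite K0_oppE K0_addE.
by apply: K0_eq; exact: K0addNr.
Qed.

HB.instance Definition _ :=
  GRing.isZmodule.Build K0 K0_addA K0_addC K0_add0 K0_addN.

Lemma K0_mulA : associative K0_mul.
Proof.
move=> u v w; have [[a ->] [b ->]] := (K0_surj u, K0_surj v).
have [c ->] := K0_surj w.
rewrite !K0_mulE.
by apply: K0_eq; exact: K0mulrA.
Qed.

Lemma K0_mulC : commutative K0_mul.
Proof. by move=> u v; apply: K0_eq; exact: K0mulrC. Qed.

Lemma K0_mul1 : left_id (\pi_K0 K0one) K0_mul.
Proof.
by move=> u; have [a ->] := K0_surj u; rewrite K0_mulE; apply: K0_eq; exact: K0mul1r.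
Qed.

Lemma K0_mulDl : left_distributive K0_mul K0_add.
Proof.
move=> u v w; have [[a ->] [b ->]] := (K0_surj u, K0_surj v).
have [c ->] := K0_surj w.
rewrite (K0_addE a b) !K0_mulE K0_addE.
by apply: K0_eq; exact: K0mulrDl.
Qed.

HB.instance Definition _ :=
  GRing.Zmodule_isComPzRing.Build K0 K0_mulA K0_mulC K0_mul1 K0_mulDl.

Definition K0class (X : qpvar k) : K0 := \pi_K0 (K0gen X).

End Grothendieck.

Section Permutohedron.
Variable R : realType.

(* The convex hull of the permutations of (1, ..., n). *)
Definition permutohedron n : set 'rV[R]_n :=
  [set x | exists c : 'S_n -> R,
     [/\ forall s, 0 <= c s, \sum_s c s = 1 &
         x = \sum_s c s *: \row_i (s i).+1%:R]].

(* All lattice points of the permutohedron: its points have coordinates in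
   the interval [1, n]. *)
Definition permutohedron_lattice n : {set {ffun 'I_n -> 'I_n.+1}} :=
  [set a : {ffun 'I_n -> 'I_n.+1} |
     `[< permutohedron (\row_i (a i)%:R) >]]%SET.

(* The toric variety of a very ample lattice polytope P is X_A for A the set
   of lattice points of P.  The m-dimensional permutohedron is very ample: its
   edge vectors at a vertex v form a basis of the lattice of integer vectors
   of sum zero, and they belong to P - v. *)
Definition permutohedral_variety m : qpvar R[i] :=
  toric_variety R[i] (permutohedron_lattice m.+1).

End Permutohedron.

Section Series.

(* A : nat -> K represents the series sum_n (A n) x^n / n!.  As
   x^p/p! * x^q/q! = 'C(p + q, p) x^(p+q)/(p+q)!, the product makes sense over
   any commutative ring. *)
Definition egf_mul (K : comPzRingType) (a b : nat -> K) : nat -> K :=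
  fun n => \sum_(i < n.+1) (a i * b (n - i)%N) *+ 'C(n, i).

Definition series_mul (K : pzRingType) (a b : nat -> K) : nat -> K :=
  fun n => \sum_(i < n.+1) a i * b (n - i)%N.

Definition series_one (K : pzRingType) : nat -> K := fun n => (n == 0)%:R.

(* The coefficients of the power series sum_n phi (a n) x^n / n!. *)
Definition egf_series (K : pzRingType) (B : comAlgType rat)
    (phi : K -> B) (a : nat -> K) : nat -> B :=
  fun n => (n`!%:R)^-1 *: phi (a n).

Variable R : realType.

Definition pi_egf (n : nat) : K0 R[i] :=
  if n is m.+1 then K0class (permutohedral_variety R m) else 1.

Definition tau_egf (n : nat) : K0 R[i] :=
  if n is m.+1 then - K0class (torus R[i] m) else 1.

End Series.

(* Main.v *)
From mathcomp Require Import all_fingroup all_boot all_order all_algebra.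
From mathcomp Require Import boolp classical_sets reals.
From mathcomp Require Import mpoly complex.
From mathcomp Require Import zify ring.
Require Import Defs.

(* The lattice points of the permutohedron are the integer solutions of Rado's
   inequalities a(S) >= 1 + ... + #|S|, with equality for the full set, and the
   facet of a proper nonempty S is where the S-inequality is tight.  If a point
   lies on the facets of S and T, then S and T are comparable, since the bound
   is strictly supermodular.  Hence the points of the permutohedral variety are
   partitioned according to the largest proper S whose facet contains their
   support (S empty if there is none).
   The facet of S is the product of the permutohedra of S and of its
   complement, so the stratum of S is the Segre product of the permutohedral
   variety of S with the open stratum of the complement; the closure contains
   it by degenerating along the one-parameter subgroup of S.  The open stratum
   is the torus: in terms of a vertex v in the support and of its neighbours
   w_q, every lattice point is v + sum_q m_q (w_q - v) with m_q >= 0, so all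
   coordinates are determined by the ratios x_(w_q) / x_v, and these do not
   vanish because x lies on no facet.
   In K_0 this gives [X^(n-1)] = sum_(S proper) [X^(#|S|-1)] [T^(n-#|S|-1)],
   with the convention that the first factor is 1 for S empty, which is the
   coefficient of x^n/n! in pi(x) tau(x) = 1. *)

Set Implicit Arguments.
Unset Strict Implicit.
Unset Printing Implicit Defensive.

Import GRing.Theory Num.Theory.

(** * Lattice points of the permutohedron *)

Local Open Scope nat_scope.

(** The triangular number 1 + ... + [s], the least total allowed on [s] coordinates. *)
Definition tri s := 'C(s.+1, 2).

Lemma triS s : tri s.+1 = tri s + s.+1.
Proof. by rewrite /tri binS bin1. Qed.

Lemma triE s : 2 * tri s = s * s.+1.
Proof. by elim: s => [|s IH] //; rewrite triS mulnDr IH; lia. Qed.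

(** The cross term [p * q] is the source of strict supermodularity; it also pays for the shift by
    [#|S|] on the complement of [S]. *)
Lemma triD p q : tri (p + q) = tri p + tri q + p * q.
Proof. by have := triE (p + q); have := triE p; have := triE q; lia. Qed.

Lemma sum_eqb (I : finType) (U : {set I}) j : \sum_(x in U) (x == j : nat) = (j \in U).
Proof.
case: (boolP (j \in U)) => jU.
  by rewrite (bigD1 j) //= eqxx big1 // => x /andP[_ /negPf ->].
by rewrite big1 // => x xU; case: eqP => // xj; rewrite -xj xU in jU.
Qed.

(* Rado's inequalities, which cut out the permutohedron of the permutations of
   (1, ..., #|I|). *)
Definition permutohedral (I : finType) (a : I -> nat) :=
  (forall U : {set I}, tri #|U| <= \sum_(i in U) a i) /\ \sum_i a i = tri #|I|.

Section Permutohedral.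
Variables (I : finType) (a : I -> nat).
Hypothesis aP : permutohedral a.

Lemma permutohedral_gt0 i : 0 < a i.
Proof. by have := aP.1 [set i]; rewrite cards1 big_set1. Qed.

Lemma permutohedral_le i : a i <= #|I|.
Proof.
have := aP.1 (~: [set i]); have := aP.2; rewrite (bigD1 i) //=.
rewrite (eq_bigl (mem (~: [set i]))) => [|x]; last by rewrite !inE.
have := cardsC1 i; have : 0 < #|I| by apply/card_gt0P; exists i.
by case: #|I| => // m _ /= ->; rewrite triS; lia.
Qed.

(** Let [#|S| = r + p] and [#|T| = r + q] with [r = #|S :&: T|]. Adding the inequalities for the
    union and the intersection gives [p * q <= 0], so [S] or [T] equals the intersection. *)
Lemma tight_comparable (S T : {set I}) :
  \sum_(i in S) a i = tri #|S| -> \sum_(i in T) a i = tri #|T| ->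
  (S \subset T) || (T \subset S).
Proof.
move=> aS aT; have := aP.1 (S :|: T); have := aP.1 (S :&: T) => h1 h2.
have e1 : \sum_(i in T) a i = \sum_(i in S :&: T) a i + \sum_(i in T :\: S) a i.
  by rewrite (big_setID S) /= finset.setIC.
have e2 : \sum_(i in S :|: T) a i = \sum_(i in S) a i + \sum_(i in T :\: S) a i.
  rewrite (big_setID S) /= finset.setIUl finset.setIid.
  rewrite finset.setDUl finset.setDv finset.set0U.
  by rewrite (finset.setUidPl _) // finset.subsetIr.
rewrite e2 aS in h2; rewrite aT in e1.
have c := cardsUI S T.
have sS := finset.subsetIl S T; have sT := finset.subsetIr S T.
have iS := subset_leq_card sS; have iT := subset_leq_card sT.
have /orP[] : (#|S :&: T| == #|S|) || (#|S :&: T| == #|T|).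
- have [p sE] : exists p, #|S| = #|S :&: T| + p by exists (#|S| - #|S :&: T|); lia.
  have [q tE] : exists q, #|T| = #|S :&: T| + q by exists (#|T| - #|S :&: T|); lia.
  have uE : #|S :|: T| = #|S :&: T| + p + q by lia.
  move: h1 h2 e1; rewrite uE sE tE !triD mulnDl => h1 h2 e1.
  suff /eqP : p * q = 0 by rewrite muln_eq0 => /orP[] /eqP ->; rewrite addn0 eqxx ?orbT.
  by lia.
- by move/eqP => h; apply/orP; left; apply/finset.setIidPl/eqP; rewrite eqEcard sS h /=.
- by move/eqP => h; apply/orP; right; apply/finset.setIidPr/eqP; rewrite eqEcard sT h /=.
Qed.

(** One unit moves from [j] to [i]. Only a set [U] with [j] but without [i] loses; there the average
    of the inequalities for [i |: U] and [U :\ j] leaves half a unit to spare, hence a whole one by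
    integrality. *)
Lemma exchange_permutohedral (b : I -> nat) i j : i != j -> a i = a j ->
  (forall x, b x + (x == j) = a x + (x == i)) -> permutohedral b.
Proof.
move=> ij aij bE.
have bS (U : {set I}) : \sum_(x in U) b x + (j \in U) = \sum_(x in U) a x + (i \in U).
  by rewrite -!sum_eqb -!big_split; apply: eq_bigr => x _; exact: bE.
split=> [U|]; last first.
  have sumT (f : I -> nat) : \sum_(x in [set: I]%SET) f x = \sum_x f x.
    by apply: eq_bigl => x; rewrite inE.
  by have := bS [set: I]%SET; rewrite !inE => /addIn; rewrite !sumT aP.2.
have := bS U; have := aP.1 U.
case: (boolP (i \in U)); case: (boolP (j \in U)) => jU iU /=; try lia.
have := aP.1 (i |: U); rewrite big_setU1 //= cardsU1 iU add1n triS.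
have := aP.1 (U :\ j); rewrite (big_setD1 j jU) /=.
by have := cardsD1 j U; rewrite jU add1n => ->; rewrite triS; lia.
Qed.

End Permutohedral.

(** Induction that removes the largest element [j]: all of [T] lies in 0, ..., [j], so
    [#|T| <= j.+1]. *)
Lemma tri_le_sum n (T : {set 'I_n}) : tri #|T| <= \sum_(j in T) j.+1.
Proof.
move: {2}#|T| (erefl #|T|) => m; elim: m T => [|m IH] T cT; first by rewrite cT.
have /card_gt0P[j0 j0T] : 0 < #|T| by rewrite cT.
case: (arg_maxnP (fun j : 'I_n => j : nat) j0T) => j /= jT' jmax; have jT : j \in T by [].
have cTj : #|T| <= j.+1.
  rewrite -(card_ord j.+1) -(card_in_imset (f := fun x : 'I_n => inord x : 'I_j.+1)).
    exact: max_card.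
  move=> x y xT yT /(congr1 val); rewrite /= !inordK ?ltnS; [|exact: jmax..].
  by move/ord_inj.
have cD : #|T :\ j| = m by have := cardsD1 j T; rewrite jT cT => -[].
rewrite (big_setD1 j jT) /= cT triS addnC leq_add -?cT // -cD.
exact: IH.
Qed.

Lemma sum_ord_succ n : \sum_(j < n) j.+1 = tri n.
Proof. by elim: n => [|n IH]; rewrite ?big_ord0 // big_ord_recr /= IH triS. Qed.

Lemma perm_permutohedral n (s : 'S_n) : permutohedral (fun i => (s i).+1).
Proof.
split=> [U|]; last first.
  rewrite card_ord -sum_ord_succ [RHS](reindex_inj (@perm_inj _ s)) /=.
  exact: eq_bigr.
rewrite -(card_imset _ (@perm_inj _ s)) -(big_imset (fun j : 'I_n => j.+1)) /=.
  exact: tri_le_sum.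
by move=> x y _ _; exact: perm_inj.
Qed.

Definition lattice_point n (a : {ffun 'I_n -> 'I_n.+1}) :=
  permutohedral (fun i => a i : nat).

Lemma permutohedral_ffun n (b : 'I_n -> nat) : permutohedral b ->
  exists2 a : {ffun 'I_n -> 'I_n.+1}, lattice_point a & forall i, a i = b i :> nat.
Proof.
move=> bP; pose a := [ffun i => inord (b i)] : {ffun 'I_n -> 'I_n.+1}.
have aE i : a i = b i :> nat.
  by rewrite ffunE inordK // ltnS; have := permutohedral_le bP i; rewrite card_ord.
exists a => //; rewrite /lattice_point.
by have -> : (fun i => a i : nat) = b by exact/funext.
Qed.

Definition vertex n (s : 'S_n) : {ffun 'I_n -> 'I_n.+1} :=
  [ffun i => lift ord0 (s i)].

Lemma vertexE n (s : 'S_n) i : vertex s i = (s i).+1 :> nat.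
Proof. by rewrite ffunE. Qed.

Lemma vertex_lattice_point n (s : 'S_n) : lattice_point (vertex s).
Proof.
rewrite /lattice_point; have -> : (fun i => vertex s i : nat) = (fun i => (s i).+1).
  by apply/funext => i; rewrite vertexE.
exact: perm_permutohedral.
Qed.

(* A lattice point with two equal coordinates is the midpoint of two lattice
   points of larger euclidean norm; without equal coordinates it is a vertex. *)
Lemma lattice_point_ind n (P : {ffun 'I_n -> 'I_n.+1} -> Prop) :
  (forall s, P (vertex s)) ->
  (forall a b c : {ffun 'I_n -> 'I_n.+1}, lattice_point a -> lattice_point b ->
     lattice_point c -> (forall i, b i + c i = a i + a i) -> P b -> P c -> P a) ->
  forall a : {ffun 'I_n -> 'I_n.+1}, lattice_point a -> P a.
Proof.
move=> Pv Pm a; pose N (a : {ffun 'I_n -> 'I_n.+1}) := \sum_i a i * a i.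
have Nle (b : {ffun 'I_n -> 'I_n.+1}) : N b <= \sum_(i < n) n * n.
  by apply: leq_sum => i _; rewrite leq_mul // -ltnS.
(* The squared norm [N] is bounded, so the induction runs on its distance to the bound. *)
have [m] := ubnP (\sum_(i < n) n * n - N a).
elim: m a => // m IH a; rewrite ltnS => Nm aP.
have [/injectiveP ainj|/injectivePn[i [j ij aij]]] := boolP (injectiveb a).
  have a_gt0 i : 0 < a i by exact: (permutohedral_gt0 aP).
  have lt_a i : (a i).-1 < n by have := ltn_ord (a i); have := a_gt0 i; lia.
  pose f i := Ordinal (lt_a i).
  have finj : injective f.
    move=> i j /(congr1 val) /= eij; apply: ainj; apply: ord_inj.
    by have := a_gt0 i; have := a_gt0 j; lia.
  have -> : a = vertex (perm finj).
    by apply/ffunP => i; apply: ord_inj; rewrite vertexE permE /= prednK.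
  exact: Pv.
have {}aij : a i = a j :> nat by rewrite aij.
have ji : j != i by rewrite eq_sym.
have step p q : p != q -> a p = a q :> nat -> exists b : {ffun 'I_n -> 'I_n.+1},
    [/\ lattice_point b, P b & forall x, b x + (x == q) = a x + (x == p)].
  move=> pq apq; pose b' x := a x + (x == p) - (x == q).
  have b'E x : b' x + (x == q) = a x + (x == p).
    by rewrite /b'; have := permutohedral_gt0 aP x; case: (x == q); case: (x == p); lia.
  have [b bP bE] := permutohedral_ffun (exchange_permutohedral aP pq apq b'E).
  have {}bE x : b x + (x == q) = a x + (x == p) by rewrite bE.
  exists b; split=> //; apply: IH => //.
  suff : N a < N b by have := Nle b; lia.
  have sumq (f : 'I_n -> nat) r : \sum_x (x == r) * f x = f r.
    rewrite (bigD1 r) //= eqxx mul1n big1 ?addn0 // => x /negPf ->.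
    by rewrite mul0n.
  (* Since [a p = a q], this identity says [N b = N a + 2]. *)
  have : N b + \sum_x (x == q) * (2 * a x) =
         N a + \sum_x (x == p) * (2 * a x) + \sum_x (x == p) * 1 + \sum_x (x == q) * 1.
    rewrite -!big_split; apply: eq_bigr => x _ /=.
    have := bE x; case: (eqVneq x p) => [xp|_]; case: (eqVneq x q) => [xq|_] /=.
    - by move: pq; rewrite -xp -xq eqxx.
    - by rewrite addn0 => ->; lia.
    - by rewrite addn0 => <-; lia.
    - by rewrite !addn0 => ->; lia.
  by rewrite !sumq /= apq; lia.
have [b [bP Pb bE]] := step i j ij aij.
have [c [cP Pc cE]] := step j i ji (esym aij).
apply: (Pm a b c) => // x; have := bE x; have := cE x.
by lia.
Qed.

(** * Lattice points of the convex hull as solutions of Rado's inequalities *)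

Section Lattice.
Variable R : realType.
Local Open Scope ring_scope.

Lemma permutohedron_midpoint n (x y z : 'rV[R]_n) :
  permutohedron y -> permutohedron z -> y + z = x + x -> permutohedron x.
Proof.
move=> [c [c0 c1 ->]] [d [d0 d1 ->]] yz.
exists (fun s => (c s + d s) / 2%:R); split=> [s||].
- by rewrite divr_ge0 ?addr_ge0 ?ler0n.
- by rewrite -mulr_suml big_split /= c1 d1 -[1 + 1]/(2%:R) divff ?pnatr_eq0.
have -> : x = 2%:R^-1 *: (x + x).
  by rewrite -mulr2n -scaler_nat scalerA mulVf ?pnatr_eq0 ?scale1r.
rewrite -yz -big_split scaler_sumr; apply: eq_bigr => s _ /=.
by rewrite -scalerDl scalerA mulrC.
Qed.

(** Convex combinations inherit Rado's inequalities from the vertices; conversely,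
    [lattice_point_ind] reaches every solution from the vertices by midpoints. *)
Lemma permutohedron_latticeP n (a : {ffun 'I_n -> 'I_n.+1}) :
  a \in permutohedron_lattice R n <-> lattice_point a.
Proof.
rewrite inE; split=> [/asboolP[c [c0 c1 aE]]|].
  have sumE (U : {set 'I_n}) : (\sum_(i in U) a i)%:R =
      \sum_s c s * (\sum_(i in U) (s i).+1)%:R :> R.
    under [RHS]eq_bigr do rewrite natr_sum mulr_sumr.
    rewrite exchange_big natr_sum; apply: eq_bigr => i _ /=.
    have := congr1 (fun v : 'rV_n => v 0 i) aE; rewrite mxE => ->.
    by rewrite summxE; apply: eq_bigr => s _; rewrite !mxE.
  split=> [U|].
    rewrite -(ler_nat R) sumE -[leLHS]mul1r -[X in X * _ <= _]c1.
    rewrite mulr_suml ler_sum // => s _.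
    by apply: ler_wpM2l => //; rewrite ler_nat (perm_permutohedral s).1.
  have := sumE [set: 'I_n]%SET.
  under [X in X%:R = _ -> _]eq_bigl do rewrite inE.
  move=> H; apply: (@mulrIn R 1 (oner_neq0 _)); rewrite H.
  rewrite -[RHS]mul1r -[X in _ = X * _]c1 mulr_suml; apply: eq_bigr => s _.
  rewrite -(perm_permutohedral s).2; congr (_ * _%:R).
  by apply: eq_bigl => i; rewrite inE.
move=> aP; apply/asboolP; move: a aP; apply: lattice_point_ind => [s|a b c _ _ _ bc].
  exists (fun s' => (s' == s)%:R); split=> [s'||].
  - by rewrite ler0n.
  - by rewrite (bigD1 s) //= eqxx big1 ?addr0 // => i /negPf ->.
  rewrite (bigD1 s) //= eqxx scale1r big1 ?addr0 => [|i /negPf ->]; last exact: scale0r.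
  by apply/rowP => i; rewrite !mxE vertexE.
move=> Pb Pc; apply: permutohedron_midpoint Pb Pc _.
by apply/rowP => i; rewrite !mxE -!natrD bc.
Qed.

End Lattice.

(** * Facets: restriction to a subset and to its complement, and gluing *)

Definition tight (I : finType) (S : {set I}) (a : I -> nat) :=
  \sum_(i in S) a i == tri #|S|.

Definition trace (I : finType) (S U : {set I}) : {set 'I_#|S|} :=
  [set j | enum_val j \in U].

Lemma sum_trace (I : finType) (S U : {set I}) (f : I -> nat) :
  \sum_(i in U) f i = \sum_(j in trace S U) f (enum_val j) +
                      \sum_(j in trace (~: S) U) f (enum_val j).
Proof.
have tr (V : {set I}) : \sum_(j in trace V U) f (enum_val j) = \sum_(i in U :&: V) f i.
  under eq_bigl do rewrite inE.
  by rewrite -big_enum_val_cond /=; apply: eq_bigl => i; rewrite !inE andbC.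
by rewrite !tr -finset.setDE -big_setID.
Qed.

Lemma card_trace (I : finType) (S U : {set I}) :
  #|U| = #|trace S U| + #|trace (~: S) U|.
Proof. by rewrite -[LHS]sum1_card (sum_trace S) !sum1_card. Qed.

Lemma trace_set (I : finType) (S U : {set I}) : S \subset U -> trace S U = [set: _]%SET.
Proof. by move=> SU; apply/setP => j; rewrite !inE (fintype.subsetP SU) // enum_valP. Qed.

Lemma traceC (I : finType) (S U : {set I}) : U \subset S -> trace (~: S) U = finset.set0.
Proof.
move=> US; apply/setP => j; rewrite !inE; apply/negP => jU.
by have := enum_valP j; rewrite inE (fintype.subsetP US).
Qed.

Lemma trace_imset (I : finType) (S : {set I}) (V : {set 'I_#|S|}) (T : {set I}) :
  [disjoint S & T] -> trace S (T :|: enum_val @: V) = V.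
Proof.
move=> ST; apply/setP => j; rewrite !inE (disjointFr ST (enum_valP j)) /=.
by rewrite mem_imset //; exact: enum_val_inj.
Qed.

Section Restriction.
Variables (I : finType) (S : {set I}) (a : I -> nat).

Lemma restrictl_permutohedral : permutohedral a -> tight S a ->
  permutohedral (fun j : 'I_#|S| => a (enum_val j)).
Proof.
move=> aP /eqP aS; split=> [U|]; last first.
  by rewrite card_ord -big_enum_val.
have := aP.1 (enum_val @: U); rewrite card_imset; last exact: enum_val_inj.
by rewrite big_imset //; apply: in2W; exact: enum_val_inj.
Qed.

Lemma tight_le x : permutohedral a -> tight S a -> x \notin S -> #|S| < a x.
Proof.
move=> aP /eqP aS xS; have := aP.1 (x |: S).
by rewrite cardsU1 xS add1n triS big_setU1 //= aS; lia.
Qed.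

(** Rado's inequality is applied to [S] together with a subset [U] of its complement. Tightness
    cancels [tri #|S|], and the cross term of [triD] is the shift by [#|S|] on each element of
    [U]. *)
Lemma restrictr_permutohedral : permutohedral a -> tight S a ->
  permutohedral (fun j : 'I_#|~: S| => a (enum_val j) - #|S|).
Proof.
move=> aP aS; have aSE := eqP aS.
have lt_a j : #|S| < a (enum_val (j : 'I_#|~: S|)).
  by apply: tight_le => //; have := enum_valP j; rewrite inE.
have sumE (U : {set 'I_#|~: S|}) : \sum_(j in U) (a (enum_val j) - #|S|) + #|U| * #|S| =
    \sum_(j in U) a (enum_val j).
  rewrite -sum_nat_const -big_split; apply: eq_bigr => j _ /=.
  by have := lt_a j; lia.
have dS : [disjoint ~: S & S] by rewrite finset.disjoints_subset subxx.
split=> [U|].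
  have := aP.1 (S :|: enum_val @: U).
  rewrite (card_trace S) (sum_trace S) trace_imset // trace_set ?finset.subsetUl //.
  rewrite cardsT card_ord; under [X in _ <= X + _]eq_bigl do rewrite inE.
  by rewrite -big_enum_val aSE triD -sumE [#|S| * _]mulnC addnA leq_add2r leq_add2l.
have := sumE [set: _]%SET; rewrite cardsT.
under eq_bigl do rewrite inE; under [RHS]eq_bigl do rewrite inE.
have := aP.2; rewrite -(cardsC S) triD.
have -> : \sum_i a i = \sum_(i in S) a i + \sum_(i in ~: S) a i.
  rewrite (bigID (mem S)) /=; congr addn.
  by apply: eq_bigl => i; rewrite inE.
rewrite aSE -big_enum_val card_ord -addnA [#|S| * _]mulnC => /addnI aC aR.
by apply: (@addIn (#|~: S| * #|S|)); rewrite aR -aC.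
Qed.

(** Allows the condition of lying on no larger face to be tested on the factor of the complement. *)
Lemma tight_trace (T : {set I}) : permutohedral a -> tight S a -> S \subset T ->
  tight T a = tight (trace (~: S) T) (fun j => a (enum_val j) - #|S|).
Proof.
move=> aP aS ST; have aSE := eqP aS; rewrite /tight (sum_trace S T) (card_trace S T).
rewrite trace_set //; under [X in X + _ == _]eq_bigl do rewrite inE.
rewrite -big_enum_val aSE triD cardsT card_ord.
set U := trace _ _.
have -> : \sum_(j in U) a (enum_val j) =
          \sum_(j in U) (a (enum_val j) - #|S|) + #|U| * #|S|.
  rewrite -sum_nat_const -big_split; apply: eq_bigr => j _ /=.
  suff : #|S| < a (enum_val j) by lia.
  by apply: tight_le => //; have := enum_valP j; rewrite inE.
by apply/eqP/eqP; lia.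
Qed.

(** If [U] has [p] elements in [S] and [q] outside, the shift contributes [q * #|S|], which covers
    the cross term [p * q] of [triD] because [p <= #|S|]. *)
Lemma glue_permutohedral (b : 'I_#|S| -> nat) (c : 'I_#|~: S| -> nat) :
  permutohedral b -> permutohedral c -> (forall j, a (enum_val j) = b j) ->
  (forall j, a (enum_val j) = c j + #|S|) -> permutohedral a /\ tight S a.
Proof.
move=> bP cP ab ac.
have sumE (U : {set I}) : \sum_(i in U) a i = \sum_(j in trace S U) b j +
    \sum_(j in trace (~: S) U) c j + #|trace (~: S) U| * #|S|.
  rewrite (sum_trace S) -addnA -sum_nat_const -big_split.
  by congr addn; apply: eq_bigr => j _; rewrite ?ab ?ac.
have bT : \sum_j b j = tri #|S| by rewrite bP.2 card_ord.
have cT : \sum_j c j = tri #|~: S| by rewrite cP.2 card_ord.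
have sumT m (f : 'I_m -> nat) : \sum_(j in [set: 'I_m]%SET) f j = \sum_j f j.
  by apply: eq_bigl => j; rewrite inE.
split; last first.
  rewrite /tight sumE trace_set // traceC // sumT bT.
  by rewrite big_set0 cards0 !addn0.
split=> [U|].
  rewrite sumE (card_trace S U) triD.
  have le_trace : #|trace S U| <= #|S| by rewrite -[leqRHS]card_ord max_card.
  by rewrite mulnC !leq_add ?leq_mul2l ?le_trace ?orbT ?bP.1 ?cP.1.
have := sumE [set: I]%SET.
rewrite !trace_set ?finset.subsetT // !sumT bT cT cardsT card_ord.
have -> : \sum_(i in [set: I]%SET) a i = \sum_i a i by apply: eq_bigl => i; rewrite inE.
by rewrite -(cardsC S) triD; lia.
Qed.

End Restriction.

(** * Cones over quasi-projective sets *)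

Local Open Scope ring_scope.
Local Open Scope classical_set_scope.

Section Cones.
Variable k : fieldType.

Lemma hcoord_inj N (L L' : pspace k N) x : hcoord L x -> hcoord L' x -> L = L'.
Proof. by rewrite /hcoord => Lx L'x; apply: val_inj; rewrite Lx L'x. Qed.

Lemma hcoordZ N (L : pspace k N) c x : c != 0 -> hcoord L x -> hcoord L (c *: x).
Proof.
move=> c0 Lx; have x0 := hcoord_neq0 Lx; rewrite /hcoord Lx.
apply/esym/eqP; rewrite eqEdim -memvE memvZ ?memv_line //=.
by rewrite !dim_vline scaler_eq0 negb_or c0 x0.
Qed.

(** The affine cone without its apex: maps and equations are checked on coordinate vectors instead
    of lines. *)
Definition cone N (X : set (pspace k N)) (x : 'rV[k]_N) :=
  exists2 L, X L & hcoord L x.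

Lemma coneP N (X : set (pspace k N)) L x : hcoord L x -> cone X x <-> X L.
Proof.
by move=> Lx; split=> [[L' XL' L'x]|XL]; [rewrite (hcoord_inj Lx L'x) | exists L].
Qed.

Lemma cone_neq0 N (X : set (pspace k N)) x : cone X x -> x != 0.
Proof. by case=> L _; exact: hcoord_neq0. Qed.

Lemma coneZ N (X : set (pspace k N)) c x : c != 0 -> cone X x -> cone X (c *: x).
Proof. by move=> c0 [L XL Lx]; exists L => //; exact: hcoordZ. Qed.

Definition polymap N M (F : 'I_M -> {mpoly k[N]}) (x : 'rV[k]_N) : 'rV[k]_M :=
  \row_i (F i).@[x 0].

Lemma mevalZ_homog N d (f : {mpoly k[N]}) c (x : 'rV[k]_N) :
  f \is d.-homog -> f.@[(c *: x) 0] = c ^+ d * f.@[x 0].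
Proof.
by move=> hf; rewrite -(homog_meval _ _ hf); apply: meval_eq => i; rewrite mxE.
Qed.

Lemma polymapZ N M d (F : 'I_M -> {mpoly k[N]}) c x :
  (forall i, F i \is d.-homog) -> polymap F (c *: x) = c ^+ d *: polymap F x.
Proof. by move=> hF; apply/rowP => i; rewrite !mxE (mevalZ_homog _ _ (hF i)). Qed.

(** By homogeneity the image line does not depend on the chosen coordinates. The whole space serves
    as the neighbourhood of every point, since vectors of a cone are nonzero. *)
Lemma regular_polymap (X Y : qpvar k) d
    (F : 'I_(qpcoords Y) -> {mpoly k[qpcoords X]}) :
  (forall i, F i \is d.-homog) ->
  (forall x, cone (qpset X) x -> cone (qpset Y) (polymap F x)) ->
  exists2 f : qppoints X -> qppoints Y, regular f &
    forall p x, hcoord (sval p) x -> hcoord (sval (f p)) (polymap F x).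
Proof.
move=> hF FXY.
have /choice[f fP] : forall p : qppoints X, exists q : qppoints Y,
    forall x, hcoord (sval p) x -> hcoord (sval q) (polymap F x).
  move=> [L XL]; have [x x0 Lx] := hcoord_exists L.
  have [L' YL' L'x] := FXY x (ex_intro2 _ _ L XL Lx).
  exists (exist _ L' YL') => y Ly /=; have [c c0 ->] := hcoord_scale Lx Ly.
  by rewrite (polymapZ _ _ hF); apply: hcoordZ => //; rewrite expf_neq0.
exists f => // p; exists setT, d, F; split=> //; first exact: zopenT.
by move=> q x _; exact: fP.
Qed.

Lemma qpiso_polymap (X Y : qpvar k) d e
    (F : 'I_(qpcoords Y) -> {mpoly k[qpcoords X]})
    (G : 'I_(qpcoords X) -> {mpoly k[qpcoords Y]}) :
  (forall i, F i \is d.-homog) -> (forall i, G i \is e.-homog) ->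
  (forall x, cone (qpset X) x -> cone (qpset Y) (polymap F x)) ->
  (forall y, cone (qpset Y) y -> cone (qpset X) (polymap G y)) ->
  (forall x, cone (qpset X) x -> exists2 c, c != 0 & polymap G (polymap F x) = c *: x) ->
  (forall y, cone (qpset Y) y -> exists2 c, c != 0 & polymap F (polymap G y) = c *: y) ->
  qpiso X Y.
Proof.
move=> hF hG FXY GYX GF FG.
have [f rf fP] := regular_polymap hF FXY.
have [g rg gP] := regular_polymap hG GYX.
have valI (Z : qpvar k) (p q : qppoints Z) x :
    hcoord (sval p) x -> hcoord (sval q) x -> p = q.
  case: p q => [p Zp] [q Zq] /= px qx; have pq := hcoord_inj px qx; subst q.
  by rewrite (Prop_irrelevance Zp Zq).
have unZ (Z : qpvar k) (p q : qppoints Z) c x : c != 0 -> hcoord (sval p) x ->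
    hcoord (sval q) (c *: x) -> q = p.
  by move=> c0 px qx; apply: valI qx _; exact: hcoordZ.
exists f, g; split=> //.
- move=> p; have [x x0 px] := hcoord_exists (sval p).
  have [c c0 cE] := GF x (ex_intro2 _ _ _ (svalP p) px).
  by apply: (unZ _ _ _ c x c0 px); rewrite -cE; exact/gP/fP.
- move=> q; have [y y0 qy] := hcoord_exists (sval q).
  have [c c0 cE] := FG y (ex_intro2 _ _ _ (svalP q) qy).
  by apply: (unZ _ _ _ c y c0 qy); rewrite -cE; exact/fP/gP.
Qed.

Section Toric.
Variables (n b : nat) (A : {set {ffun 'I_n -> 'I_b}}).

Definition monomial (a : {ffun 'I_n -> 'I_b}) (t : 'I_n -> k) := \prod_i t i ^+ a i.

Definition monomials (t : 'I_n -> k) : 'rV[k]_#|A| :=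
  \row_j monomial (enum_val j) t.

(** The form in which the Zariski closure is used: homogeneous equations that hold at all torus
    points hold on the variety. *)
Lemma cone_toric x : cone (qpset (toric_variety k A)) x <-> x != 0 /\
  forall d (f : {mpoly k[#|A|]}), f \is d.-homog ->
    (forall t, (forall i, t i != 0) -> f.@[monomials t 0] = 0) -> f.@[x 0] = 0.
Proof.
split=> [[L ZL Lx]|[x0 fx]].
  split=> [|d f hf f0]; first exact: hcoord_neq0 Lx.
  apply: ZL Lx; split; first by exists d.
  move=> L' [t [t0 L't]]; apply/(vanishesE (ex_intro _ d hf) L't).
  exact: f0.
have [L Lx] := pspace_of x0; exists L => // f [[d hf] fL].
apply/(vanishesE (ex_intro _ d hf) Lx); apply: fx hf _ => t t0.
have mt0 : monomials t != 0.
  have /rV0Pn[j _] := x0; apply/rV0Pn; exists j.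
  by rewrite mxE; apply/prodf_neq0 => i _; rewrite expf_neq0.
have [L' L't] := pspace_of mt0; apply: (fL L') => //.
by exists t.
Qed.

End Toric.

Lemma homog_mpolyX N (i : 'I_N) : 'X_i \is [in k[N], 1.-homog].
Proof. by rewrite dhomogX /= mdeg1. Qed.

End Cones.

(** * Additivity of classes along closed filtrations *)

Section Scissors.
Variable k : closedFieldType.

(* The junk value 0 occurs when X is not locally closed. *)
Definition class N (X : set (pspace k N)) : K0 k :=
  if pselect (locally_closed X) is left lcX then K0class (QPVar lcX) else 0.

Lemma classE (X : qpvar k) : class (qpset X) = K0class X.
Proof.
case: X => N X lcX; rewrite /class /=; case: pselect => // lcX'.
by rewrite (Prop_irrelevance lcX' lcX).
Qed.

Lemma class_scissor N (X Y : set (pspace k N)) : locally_closed X ->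
  locally_closed Y -> locally_closed (X `\` Y) -> Y `<=` X ->
  class X = class Y + class (X `\` Y).
Proof.
move=> lcX lcY lcD YX; have := K0_eq (K0scissor lcX lcY lcD YX).
rewrite -[LHS]/(K0class _) -K0_addE => XE.
by rewrite (classE (QPVar lcX)) (classE (QPVar lcY)) (classE (QPVar lcD)).
Qed.

Lemma zclosed0 N : zclosed (set0 : set (pspace k N)).
Proof. by have := @zopenT k N; rewrite /zopen setCT. Qed.

Lemma class_set0 N : class (set0 : set (pspace k N)) = 0.
Proof.
have lc0 := zclosed_lc (@zclosed0 N).
have := class_scissor lc0 lc0; rewrite setD0 => /(_ lc0 (fun _ h => h)) /eqP.
by rewrite -[X in X == _]addr0 (inj_eq (addrI _)) eq_sym => /eqP.
Qed.

(** Each tail of [s] has a closed union, so removing it from [D i] leaves a locally closed set, and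
    the scissor relation peels off one term at a time from the front. *)
Lemma class_filtration (I : eqType) N (D Z : I -> set (pspace k N)) (s : seq I) :
  (forall i, zclosed (D i)) ->
  (forall s1 i s2, s = s1 ++ i :: s2 ->
     D i `\` [set L | exists2 j, j \in s2 & D j L] = Z i) ->
  class [set L | exists2 j, j \in s & D j L] = \sum_(i <- s) class (Z i).
Proof.
move=> cD; set W := fun s : seq I => [set L | exists2 j, j \in s & D j L].
have W0 : W [::] = set0 by apply/seteqP; split=> // L [].
have WS i s' : W (i :: s') = D i `|` W s'.
  apply/seteqP; split=> L.
    by move=> [j]; rewrite inE => /predU1P[->|js'] DL; [left|right; exists j].
  by move=> [DL|[j js' DL]]; [exists i|exists j]; rewrite ?inE ?eqxx ?js' ?orbT.
have cW s' : zclosed (W s').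
  elim: s' => [|i s' IH]; first by rewrite W0; exact: zclosed0.
  by rewrite WS; exact: zclosedU.
rewrite -/(W s); elim: s => [|i s IH] sZ; first by rewrite big_nil W0 class_set0.
have DW : W (i :: s) `\` W s = D i `\` W s.
  by rewrite WS setDUl setDv setU0.
rewrite big_cons -(sZ [::] i s erefl) addrC -IH => [|s1 j s2 sE]; last first.
  by apply: (sZ (i :: s1)); rewrite sE.
rewrite -DW; apply: class_scissor; try exact: zclosed_lc.
  rewrite DW; exists (~` W s), (D i); split=> //; first exact: zopenC.
  by rewrite setDE setIC.
by rewrite WS => L; right.
Qed.

End Scissors.

(** * Strata of the permutohedral variety *)

Section Strata.
Variables (R : realType) (k : closedFieldType).

Local Notation lattice n := (permutohedron_lattice R n).
Local Notation idx n := 'I_#|lattice n|.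

Lemma vertex_lattice n (s : 'S_n) : vertex s \in lattice n.
Proof. exact/permutohedron_latticeP/vertex_lattice_point. Qed.

(* An arbitrary index when [a] is not a lattice point of the permutohedron. *)
Definition index_of n (a : {ffun 'I_n -> 'I_n.+1}) : idx n :=
  enum_rank_in (vertex_lattice 1) a.

Lemma index_ofK n (a : {ffun 'I_n -> 'I_n.+1}) :
  lattice_point a -> enum_val (index_of a) = a.
Proof. by move=> /permutohedron_latticeP aL; rewrite enum_rankK_in. Qed.

Lemma enum_valK_index n (j : idx n) : index_of (enum_val j) = j.
Proof. exact: enum_valK_in. Qed.

Lemma lattice_point_enum_val n (j : idx n) : lattice_point (enum_val j).
Proof. exact/permutohedron_latticeP/enum_valP. Qed.

Definition perm_variety n : qpvar k := toric_variety k (lattice n).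

Definition face n (S : {set 'I_n}) (j : idx n) := tight S (fun i => enum_val j i : nat).

Lemma face0 n (j : idx n) : face finset.set0 j.
Proof. by rewrite /face /tight big_set0 cards0. Qed.

Definition face_set n (S : {set 'I_n}) : set (pspace k #|lattice n|) :=
  qpset (perm_variety n) `&` zeros [set f | exists2 j, ~~ face S j & f = 'X_j].

Lemma face_set_closed n (S : {set 'I_n}) : zclosed (face_set S).
Proof.
apply: zclosedI; first exact: zclosure_closed.
apply: zeros_closed => _ [j _ ->]; exists 1%N; exact: homog_mpolyX.
Qed.

Lemma cone_face_set n (S : {set 'I_n}) x : cone (face_set S) x <->
  cone (qpset (perm_variety n)) x /\ forall j, ~~ face S j -> x 0 j = 0.
Proof.
split=> [[L [XL FL] Lx]|[[L XL Lx] xF]].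
  split=> [|j jS]; first by exists L.
  by have := FL 'X_j (ex_intro2 _ _ j jS erefl) x Lx; rewrite mevalXU.
exists L => //; split=> // _ [j jS ->].
apply/(vanishesE _ Lx); first by exists 1%N; exact: homog_mpolyX.
by rewrite mevalXU xF.
Qed.

(** For [S] empty the face is the whole variety, so [stratum finset.set0] is the complement of all
    facets. *)
Definition stratum n (S : {set 'I_n}) : set (pspace k #|lattice n|) :=
  face_set S `\` [set L | exists2 T : {set 'I_n},
    (S \proper T) && (T != [set: 'I_n]%SET) & face_set T L].

Lemma cone_stratum n (S : {set 'I_n}) x : cone (stratum S) x <->
  cone (face_set S) x /\ forall T : {set 'I_n}, S \proper T -> T != [set: 'I_n]%SET ->
    exists2 j, ~~ face T j & x 0 j != 0.
Proof.
split=> [[L [SL nL] Lx]|[[L SL Lx] xT]].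
  split=> [|T ST Tt]; first by exists L.
  apply: contrapT => nT; apply: nL; exists T; first by rewrite ST.
  apply/(coneP _ Lx)/cone_face_set; split; first by exists L => //; case: SL.
  move=> j jT; apply/eqP/negPn/negP => xj; apply: nT.
  by exists j.
exists L => //; split=> // -[T /andP[ST Tt] /(coneP _ Lx)/cone_face_set[_ xF]].
by have [j jT] := xT T ST Tt; rewrite xF ?eqxx.
Qed.

Lemma stratum_lc n (S : {set 'I_n}) : locally_closed (stratum S).
Proof.
pose s := enum [pred T : {set 'I_n} | (S \proper T) && (T != [set: 'I_n]%SET)].
exists (~` [set L | exists2 T, T \in s & face_set T L]), (face_set S).
split; [apply: zopenC | exact: face_set_closed | rewrite setIC].
  elim: s => [|T s IH].
    suff -> : [set L | exists2 T : {set 'I_n}, T \in [::] & face_set T L] = set0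
      by exact: zclosed0.
    by apply/seteqP; split=> // L [].
  suff -> : [set L | exists2 U : {set 'I_n}, U \in T :: s & face_set U L] =
      face_set T `|` [set L | exists2 U : {set 'I_n}, U \in s & face_set U L].
    by apply: zclosedU => //; exact: face_set_closed.
  apply/seteqP; split=> L.
    by move=> [U]; rewrite inE => /predU1P[->|Us] UL; [left|right; exists U].
  by move=> [TL|[U Us UL]]; [exists T|exists U]; rewrite ?inE ?eqxx ?Us ?orbT.
congr (_ `&` ~` _); apply/seteqP; split=> L [T TS TL]; exists T => //;
  by move: TS; rewrite mem_enum.
Qed.

Lemma face_comparable n (S T : {set 'I_n}) (j : idx n) :
  face S j -> face T j -> (S \subset T) || (T \subset S).
Proof.
by move=> /eqP jS /eqP jT; apply: tight_comparable jS jT; exact: lattice_point_enum_val.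
Qed.

(** The faces are listed by increasing cardinality of [S], so every proper superset of [S] comes
    later, and removing the later faces leaves exactly the stratum. *)
Lemma class_strata n : (0 < n)%N ->
  K0class (perm_variety n) = \sum_(S : {set 'I_n} | S != [set: 'I_n]%SET) class (stratum S).
Proof.
move=> n0; pose r (S T : {set 'I_n}) := (#|S| <= #|T|)%N.
pose s := sort r (enum [pred T : {set 'I_n} | T != [set: 'I_n]%SET]).
have r_tr : transitive r by move=> S T U; exact: leq_trans.
have r_tot : total r by move=> S T; exact: leq_total.
have s_sort : pairwise r s by rewrite -sorted_pairwise // sort_sorted.
have s_uniq : uniq s by rewrite sort_uniq enum_uniq.
have sE T : (T \in s) = (T != [set: 'I_n]%SET) by rewrite mem_sort mem_enum.
have -> : \sum_(S : {set 'I_n} | S != [set: 'I_n]%SET) class (stratum S) =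
          \sum_(S <- s) class (stratum S).
  by rewrite (perm_big _ (permEl (perm_sort _ _))) big_enum.
rewrite -classE -(@class_filtration _ _ _ (@face_set n)) => [|S|s1 S s2 s12].
- congr class; apply/seteqP; split=> L; last by move=> [S _ []].
  (* The empty set is proper because [n] is positive, and its face is everything. *)
  move=> XL; exists finset.set0.
    by rewrite sE; apply/eqP => /setP/(_ (Ordinal n0)); rewrite !inE.
  by split=> // f [j]; rewrite face0.
- exact: face_set_closed.
move: s_sort s_uniq; rewrite s12 pairwise_cat pairwise_cons cat_uniq /=.
move=> /and3P[/allrelP r1 _ /andP[/allP r2 _]] /and3P[_ _ /andP[Ss2 _]].
apply/seteqP; split=> L [SL nL]; split=> // -[T].
  move=> /andP[ST Tt] TL; apply: nL; exists T => //.
  have := sE T; rewrite Tt s12 mem_cat inE => /or3P[Ts|/eqP TS|//].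
    have := r1 T S Ts; rewrite inE eqxx => /(_ isT); rewrite /r leqNgt.
    by rewrite proper_card.
  by move: ST; rewrite TS fintype.properxx.
move=> Ts TL; apply: nL; exists T => //.
have Tt : T != [set: 'I_n]%SET by rewrite -sE s12 mem_cat inE Ts !orbT.
rewrite Tt andbT.
have ST : S != T by apply: contraNneq Ss2 => ->.
(* A nonzero coordinate of the point belongs to both faces, so [S] and [T] are comparable; the order
   of the list rules out [T] inside [S]. *)
have [x x0 Lx] := hcoord_exists L; have /rV0Pn[j xj] := x0.
have jF (U : {set 'I_n}) : face_set U L -> face U j.
  move=> /(coneP _ Lx)/cone_face_set[_ xF]; apply/negPn/negP => jU.
  by rewrite xF ?eqxx in xj.
rewrite finset.properEneq ST /=; have /orP[//|TS] := face_comparable (jF _ SL) (jF _ TL).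
have /eqP TSE : T == S by rewrite eqEcard TS; exact: r2.
by rewrite TSE eqxx in ST.
Qed.

End Strata.

(** * The open stratum *)

Section Neighbours.
Local Open Scope nat_scope.
Variables (m : nat) (s : 'S_m.+1).

Definition lo (q : 'I_m) : 'I_m.+1 := widen_ord (leqnSn m) q.
Definition hi (q : 'I_m) : 'I_m.+1 := lift ord0 q.

(** The product applies [s] first, so the values [lo q] and [hi q] are exchanged: these are the [m]
    vertices joined to [vertex s] by an edge. *)
Definition neighbour (q : 'I_m) : 'S_m.+1 := (s * tperm (lo q) (hi q))%g.

Lemma vertex_neighbour q i :
  vertex (neighbour q) i + (s i == hi q) = vertex s i + (s i == lo q).
Proof.
have lohi : (lo q == hi q) = false by apply/eqP => /(congr1 val) /=; rewrite /bump /=; lia.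
rewrite !vertexE permM; case: tpermP => [->|->|/eqP/negPf -> /eqP/negPf ->] //.
  by rewrite lohi eqxx /= /bump; lia.
by rewrite eq_sym lohi eqxx /= /bump; lia.
Qed.

(** The slack in Rado's inequality for the [p] places where [s] is smallest. For [p = q.+1] it is
    the coefficient of [a] minus [vertex s] along the edge to [neighbour q]. *)
Definition gap (a : 'I_m.+1 -> nat) p := \sum_(i | s i < p) a i - tri p.

Lemma card_lt_perm p : p <= m.+1 -> #|[set i | s i < p]%SET| = p.
Proof.
move=> pm; rewrite -sum1_card; under eq_bigl do rewrite inE.
rewrite -(reindex_inj (@perm_inj _ s) (P := fun j : 'I_m.+1 => j < p) (F := fun=> 1)) /=.
by rewrite (big_ord_narrow_cond (P := xpredT) pm) /= sum1_card card_ord.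
Qed.

Variables (a : 'I_m.+1 -> nat) (aP : permutohedral a).

Lemma tri_le_lt p : p <= m.+1 -> tri p <= \sum_(i | s i < p) a i.
Proof.
move=> pm; rewrite -[in leqLHS](card_lt_perm pm).
by apply: leq_trans (aP.1 _) _; under eq_bigl do rewrite inE.
Qed.

Lemma tight_gap p : p <= m.+1 -> tight [set i | s i < p]%SET a = (gap a p == 0).
Proof.
move=> pm; rewrite /tight card_lt_perm // /gap; under eq_bigl do rewrite inE.
by have := tri_le_lt pm; case: ltngtP => // ; lia.
Qed.

Lemma gap0 : gap a 0 = 0.
Proof. by rewrite /gap big_pred0. Qed.

Lemma gap_max : gap a m.+1 = 0.
Proof.
rewrite /gap (eq_bigl xpredT) => [|i]; last exact: ltn_ord.
by rewrite aP.2 card_ord subnn.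
Qed.

Lemma gapS i : gap a (s i).+1 + (s i).+1 = gap a (s i) + a i.
Proof.
have le1 := tri_le_lt (ltn_ord (s i)); have le0 := tri_le_lt (ltnW (ltn_ord (s i))).
have : \sum_(j | s j < (s i).+1) a j = a i + \sum_(j | s j < s i) a j.
  rewrite (bigD1 i) //=; congr addn; apply: eq_bigl => j.
  by rewrite ltnS ltn_neqAle (inj_eq val_inj) (inj_eq perm_inj) andbC.
by rewrite /gap triS in le1 *; lia.
Qed.

(* [a] minus the vertex is a nonnegative combination of the edge vectors there. *)
Lemma gap_exponents i :
  a i + \sum_(q < m) gap a q.+1 * vertex s i =
  vertex s i + \sum_(q < m) gap a q.+1 * vertex (neighbour q) i.
Proof.
(* The value [s i] is some [lo q] unless it is [m], and some [hi q] unless it is 0; in the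
   exceptional cases the sums vanish, in agreement with [gap_max] and [gap0]. *)
have sum_lo : \sum_(q < m) gap a q.+1 * (s i == lo q) = gap a (s i).+1.
  have [sm|ms] := ltnP (s i) m.
    rewrite (bigD1 (Ordinal sm)) //= big1 => [|q qs].
      by rewrite addn0 (_ : s i == _ = true) ?muln1 //; apply/eqP/val_inj.
    rewrite (_ : s i == _ = false) ?muln0 //; apply: contraNF qs => /eqP sq.
    by apply/eqP/val_inj; rewrite /= sq.
  rewrite (_ : s i = m :> nat) ?gap_max; last by have := ltn_ord (s i); lia.
  rewrite big1 // => q _; rewrite (_ : s i == _ = false) ?muln0 //.
  by apply/eqP => sq; have := ltn_ord q; rewrite sq /= in ms; lia.
have sum_hi : \sum_(q < m) gap a q.+1 * (s i == hi q) = gap a (s i).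
  have [j sj|s0] := unliftP ord0 (s i); last first.
    by rewrite s0 /= gap0 big1 // => q _; rewrite muln0.
  rewrite (bigD1 j) //= sj eqxx muln1 big1 ?addn0 // => q qj.
  by rewrite (inj_eq lift_inj) eq_sym (negPf qj) muln0.
have : \sum_(q < m) gap a q.+1 * vertex (neighbour q) i + gap a (s i) =
       \sum_(q < m) gap a q.+1 * vertex s i + gap a (s i).+1.
  rewrite -sum_lo -sum_hi -!big_split; apply: eq_bigr => q _ /=.
  by rewrite -!mulnDr vertex_neighbour.
by have := gapS i; rewrite vertexE; lia.
Qed.

End Neighbours.

(** * Monomials on the torus and the relations they impose on the closure *)

Section Monomials.
Variable k : fieldType.

Lemma homog_prod N (I : finType) (F : I -> {mpoly k[N]}) (d : I -> nat) :
  (forall i, F i \is (d i).-homog) -> \prod_i F i \is (\sum_i d i)%N.-homog.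
Proof.
move=> hF; apply: (big_rec2 (fun p e => p \is e.-homog)) => [|i p e _ hp].
  exact: dhomog1.
exact: dhomogM.
Qed.

Lemma prod_eqb n (t : 'I_n -> k) p : \prod_i t i ^+ (i == p) = t p.
Proof. by rewrite (bigD1 p) //= eqxx expr1 big1 ?mulr1 // => i /negPf ->. Qed.

Lemma monomial_neq0 n b (a : {ffun 'I_n -> 'I_b}) (t : 'I_n -> k) :
  (forall i, t i != 0) -> monomial a t != 0.
Proof. by move=> t0; apply/prodf_neq0 => i _; rewrite expf_neq0. Qed.

Lemma monomialZ n b (a : {ffun 'I_n -> 'I_b}) c (t : 'I_n -> k) :
  monomial a (fun i => c * t i) = c ^+ (\sum_i a i) * monomial a t.
Proof.
by rewrite -prodrXr -big_split; apply: eq_bigr => i _; rewrite exprMn.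
Qed.

(** Applied below to binomials: a multiplicative relation between monomials passes from the torus to
    its closure. *)
Lemma toric_eq n b (A : {set {ffun 'I_n -> 'I_b}}) d (f g : {mpoly k[#|A|]}) x :
  f \is d.-homog -> g \is d.-homog ->
  (forall t, (forall i, t i != 0) -> f.@[monomials A t 0] = g.@[monomials A t 0]) ->
  cone (qpset (toric_variety k A)) x -> f.@[x 0] = g.@[x 0].
Proof.
move=> hf hg fg /cone_toric[_ xA]; apply/eqP; rewrite -subr_eq0 -mevalB.
apply/eqP/(xA d) => [|t t0]; first exact: rpredB.
by rewrite mevalB fg // subrr.
Qed.

(** The product of the [r q] with [q >= p]. The factors 1 keep the number of factors equal to [m],
    which gives every [to_torus i] the same degree. *)
Definition ratio_prod m (r : 'I_m -> k) (p : nat) : k :=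
  \prod_(q < m) (if (p <= q)%N then r q else 1).

Lemma ratio_prodS m (r : 'I_m -> k) (q : 'I_m) :
  ratio_prod r q = r q * ratio_prod r q.+1.
Proof.
rewrite /ratio_prod (bigD1 q) //= leqnn [in RHS](bigD1 q) //= ltnn mul1r.
congr (_ * _); apply: eq_bigr => i iq; rewrite [in RHS]ltn_neqAle.
by rewrite [(q : nat) != i](_ : _ = true) // eq_sym.
Qed.

Lemma ratio_prod_neq0 m (r : 'I_m -> k) p : (forall q, r q != 0) -> ratio_prod r p != 0.
Proof. by move=> r0; apply/prodf_neq0 => q _; case: ifP => // _; exact: oner_neq0. Qed.

Lemma ratio_prod_telescope m (t : 'I_m.+1 -> k) (p : 'I_m.+1) :
  (forall i, t i != 0) ->
  ratio_prod (fun q => t (lo q) / t (hi q)) p = t p / t ord_max.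
Proof.
move=> t0; have [e] := ubnP (m - p); elim: e p => // e IH p.
rewrite ltnS => pe; have [pm|mp] := ltnP p m; last first.
  have -> : p = ord_max by apply: val_inj => /=; have := ltn_ord p; lia.
  rewrite divff // /ratio_prod big1 //= => q _.
  by rewrite leqNgt ltn_ord.
have pE : p = lo (Ordinal pm) by exact: val_inj.
rewrite [in LHS]pE (ratio_prodS _ (Ordinal pm)).
have -> : (Ordinal pm).+1 = hi (Ordinal pm) by [].
rewrite IH; last by rewrite /= /bump /=; lia.
by rewrite -pE mulrA divfK.
Qed.

End Monomials.

Section Orbit.
Variables (R : realType) (k : closedFieldType).

Local Notation lattice n := (permutohedron_lattice R n).
Local Notation idx n := 'I_#|lattice n|.
Local Notation index_of := (@index_of R _).
Local Notation perm_variety n := (perm_variety R k n).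
Local Notation monomials n := (@monomials k n n.+1 (lattice n)).

Lemma monomials_index n (a : {ffun 'I_n -> 'I_n.+1}) (t : 'I_n -> k) :
  lattice_point a -> monomials n t 0 (index_of a) = monomial a t.
Proof. by move=> aP; rewrite mxE index_ofK. Qed.

Lemma monomialsZ n c (t : 'I_n -> k) :
  monomials n (fun i => c * t i) = c ^+ tri n *: monomials n t.
Proof.
apply/rowP => j; rewrite !mxE monomialZ; congr (_ ^+ _ * _).
by rewrite (lattice_point_enum_val j).2 card_ord.
Qed.

Lemma monomials_neq0 n (t : 'I_n -> k) : (forall i, t i != 0) -> monomials n t != 0.
Proof.
move=> t0; apply/rV0Pn; exists (index_of (vertex 1)); rewrite mxE.
exact: monomial_neq0.
Qed.

(** If [a] is the midpoint of [b] and [c], then [x_b * x_c = x_a ^ 2] on the variety, so a nonzero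
    coordinate at [a] forces one at [b]. [lattice_point_ind] carries this down to the vertices. *)
Lemma exists_vertex n (x : 'rV[k]__) : cone (qpset (perm_variety n)) x ->
  exists s : 'S_n, x 0 (index_of (vertex s)) != 0.
Proof.
move=> Xx; have /rV0Pn[j] := cone_neq0 Xx.
rewrite -(enum_valK_index j); move: (lattice_point_enum_val j).
move: (enum_val j); apply: lattice_point_ind => [s|a b c aP bP cP bc IHb IHc xa].
  by exists s.
have : x 0 (index_of b) * x 0 (index_of c) = x 0 (index_of a) * x 0 (index_of a).
  have eX (u v : idx n) (y : 'rV[k]__) : ('X_u * 'X_v).@[y 0] = y 0 u * y 0 v.
    by rewrite mevalM !mevalXU.
  rewrite -!eX; apply: (toric_eq (d := 1 + 1)) Xx; try by rewrite dhomogM ?homog_mpolyX.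
  move=> t t0; rewrite !eX !monomials_index // /monomial -!big_split.
  by apply: eq_bigr => i _ /=; rewrite -!exprD bc.
have [xb|xb _] := eqVneq (x 0 (index_of b)) 0; last exact: IHb.
move=> /esym/eqP; rewrite xb mul0r mulf_eq0 orbb.
by rewrite (negPf xa).
Qed.

Section Chart.
Variables (m : nat) (s : 'S_m.+1).

Local Notation iv := (index_of (vertex s)).
Local Notation iw q := (index_of (vertex (neighbour s q))).

(** The relation imposed by [gap_exponents], with denominators cleared. *)
Lemma toric_gap (x : 'rV[k]__) (a : {ffun 'I_m.+1 -> 'I_m.+2}) : lattice_point a ->
  cone (qpset (perm_variety m.+1)) x ->
  let g q := gap s (fun i => a i : nat) q.+1 in
  x 0 (index_of a) * x 0 iv ^+ (\sum_(q < m) g q) =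
  x 0 iv * \prod_(q < m) x 0 (iw q) ^+ g q.
Proof.
move=> aP Xx g.
pose f1 : {mpoly k[#|lattice m.+1|]} := 'X_(index_of a) * 'X_iv ^+ (\sum_(q < m) g q).
pose f2 : {mpoly k[#|lattice m.+1|]} := 'X_iv * \prod_(q < m) 'X_(iw q) ^+ g q.
have f1E (y : 'rV[k]__) : f1.@[y 0] = y 0 (index_of a) * y 0 iv ^+ (\sum_(q < m) g q).
  by rewrite mevalM rmorphXn /= !mevalXU.
have f2E (y : 'rV[k]__) : f2.@[y 0] = y 0 iv * \prod_(q < m) y 0 (iw q) ^+ g q.
  rewrite mevalM mevalXU rmorph_prod; congr (_ * _); apply: eq_bigr => q _.
  by rewrite rmorphXn /= mevalXU.
have hX i e : 'X_i ^+ e \is [in k[#|lattice m.+1|], e.-homog].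
  by rewrite -[X in X.-homog]mul1n; apply: dhomogMn; exact: homog_mpolyX.
rewrite -f1E -f2E; apply: (toric_eq (d := 1 + \sum_(q < m) g q)%N) Xx.
- by apply: dhomogM; [exact: homog_mpolyX | exact: hX].
- by apply: dhomogM; [exact: homog_mpolyX | apply: homog_prod => q; exact: hX].
move=> t t0; rewrite f1E f2E !monomials_index //; [|exact: vertex_lattice_point..].
have -> : \prod_(q < m) monomials m.+1 t 0 (iw q) ^+ g q =
          \prod_i t i ^+ (\sum_(q < m) g q * vertex (neighbour s q) i).
  under [RHS]eq_bigr do rewrite -prodrXr.
  rewrite [RHS]exchange_big; apply: eq_bigr => q _ /=.
  rewrite monomials_index; last exact: vertex_lattice_point.
  by rewrite -prodrXl; apply: eq_bigr => i _; rewrite -exprM mulnC.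
rewrite /monomial -prodrXl -!big_split; apply: eq_bigr => i _ /=.
rewrite -exprM -!exprD -(gap_exponents s aP) mulnC big_distrl /=.
by congr (_ ^+ (_ + _)); apply: eq_bigr => q _; rewrite mulnC.
Qed.

Lemma monomial_neighbour (t : 'I_m.+1 -> k) q :
  monomial (vertex (neighbour s q)) t * t ((s^-1)%g (hi q)) =
  monomial (vertex s) t * t ((s^-1)%g (lo q)).
Proof.
rewrite -(prod_eqb t ((s^-1)%g (hi q))) -(prod_eqb t ((s^-1)%g (lo q))) -!big_split.
apply: eq_bigr => i _ /=; rewrite -!exprD; congr (_ ^+ _).
have eqs j : (i == (s^-1)%g j) = (s i == j).
  by apply/eqP/eqP => [->|<-]; rewrite ?permKV ?permK.
by rewrite !eqs vertex_neighbour.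
Qed.

(** By [monomial_neighbour] the ratio at [q] is [t_(lo q) / t_(hi q)], with indices read through
    [s]. Telescoping recovers [t] up to a scalar, normalized to 1 where [s] is maximal. *)
Definition chart (x : 'rV[k]__) (i : 'I_m.+1) : k :=
  ratio_prod (fun q => x 0 (iw q) / x 0 iv) (s i).

(** The scalar [c] makes both sides agree at [vertex s], and the chart makes them agree at its
    neighbours. Both lie on the variety, where [toric_gap] determines all other coordinates. *)
Lemma chartP (x : 'rV[k]__) : cone (qpset (perm_variety m.+1)) x ->
  x 0 iv != 0 -> (forall q, x 0 (iw q) != 0) ->
  (forall i, chart x i != 0) /\ exists2 c, c != 0 & x = c *: monomials m.+1 (chart x).
Proof.
move=> Xx xv xw; set t := chart x.
have t0 i : t i != 0 by apply: ratio_prod_neq0 => q; exact: mulf_neq0 (xw q) (invr_neq0 xv).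
have v0 : monomial (vertex s) t != 0 by exact: monomial_neq0.
split=> //; pose c := x 0 iv / monomial (vertex s) t.
have c0 : c != 0 by rewrite mulf_neq0 ?invr_eq0.
exists c => //; pose y := c *: monomials m.+1 t.
have yE a : lattice_point a -> y 0 (index_of a) = c * monomial a t.
  by move=> aP; rewrite mxE monomials_index.
have yv : y 0 iv = x 0 iv by rewrite yE ?divfK //; exact: vertex_lattice_point.
have yw q : y 0 (iw q) = x 0 (iw q).
  rewrite yE; last exact: vertex_lattice_point.
  apply: (mulIf (t0 ((s^-1)%g (hi q)))); rewrite -mulrA monomial_neighbour mulrA.
  rewrite /c divfK // /t /chart !permKV [lo q : nat]/= ratio_prodS mulrA.
  by rewrite [X in X * _]mulrC divfK.
have Xy : cone (qpset (perm_variety m.+1)) y.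
  apply/cone_toric; split=> [|d f hf f0].
    by rewrite scaler_eq0 (negPf c0) (negPf (monomials_neq0 t0)).
  by rewrite (mevalZ_homog _ _ hf) f0 // mulr0.
apply/rowP => j; rewrite -/y -(enum_valK_index j).
have aP := lattice_point_enum_val j.
have /= := toric_gap aP Xy; rewrite yv; under [in RHS]eq_bigr do rewrite yw.
have /= <- := toric_gap aP Xx; move/mulIf => -> //.
by rewrite expf_neq0.
Qed.

End Chart.

(** If the identity vertex is tight on [T], exchanging its values at one place inside [T] and one
    outside changes the sum over [T]. *)
Lemma not_tight_vertex n (T : {set 'I_n}) : T != finset.set0 -> T != [set: 'I_n]%SET ->
  exists s : 'S_n, ~~ tight T (fun i => vertex s i : nat).
Proof.
move=> /set0Pn[x xT] Tt; have [y yT] : exists y, y \notin T.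
  apply/existsP; rewrite -negb_forall; apply: contra Tt => /forallP TT.
  by apply/eqP/setP => y; rewrite inE TT.
have [e1|] := boolP (tight T (fun i => vertex 1 i : nat)); last by exists 1%g.
exists (tperm x y); apply/negP => e2; move: e1 e2; rewrite /tight => /eqP <- /eqP.
rewrite (big_setD1 x xT) [in RHS](big_setD1 x xT) /= !vertexE perm1 tpermL.
have -> : (\sum_(i in T :\ x) vertex (tperm x y) i = \sum_(i in T :\ x) vertex 1 i)%N.
  apply: eq_bigr => i; rewrite !inE !vertexE perm1 => /andP[ix iT].
  rewrite tpermD // 1?eq_sym //; apply: contraNneq yT => <- //.
move=> /addIn [] /val_inj xy.
by rewrite xy xT in yT.
Qed.

Lemma cone_open_stratum m (x : 'rV[k]__) :
  cone (@stratum R k m.+1 finset.set0) x <->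
  exists c t, [/\ c != 0, forall i, t i != 0 & x = c *: monomials m.+1 t].
Proof.
split=> [/cone_stratum[/cone_face_set[Xx _] xT]|[c [t [c0 t0 xE]]]].
  have [s xv] := exists_vertex Xx.
  have xw q : x 0 (index_of (vertex (neighbour s q))) != 0.
    have qm : (q.+1 <= m.+1)%N by rewrite ltnS ltnW.
    have cS := card_lt_perm s qm.
    (* This facet contains [vertex s] but not its neighbour at [q]. A nonzero coordinate off the
       facet has a positive exponent at that neighbour in [toric_gap], so the coordinate there
       cannot vanish. *)
    have [||j jT xj] := xT [set i | (s i < q.+1)%N]%SET.
    - by rewrite finset.proper0 -card_gt0 cS.
    - apply/eqP => /(congr1 (fun T : {set _} => #|T|)); rewrite cS cardsT card_ord.
      by have := ltn_ord q; lia.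
    rewrite /face tight_gap // in jT; last exact: lattice_point_enum_val.
    rewrite -(enum_valK_index j) in xj.
    have /= /eqP := toric_gap s (lattice_point_enum_val j) Xx.
    apply: contraTneq => xq.
    rewrite [X in _ == _ * X](bigD1 q) //= xq expr0n (negPf jT) mul0r mulr0.
    by rewrite mulf_neq0 // expf_neq0.
  have [t0 [c c0 xE]] := chartP Xx xv xw.
  by exists c, (chart s x).
have x0 j : x 0 j != 0.
  by rewrite xE !mxE mulf_neq0 //; exact: monomial_neq0.
apply/cone_stratum; split.
  apply/cone_face_set; split=> [|j]; last by rewrite face0.
  apply/cone_toric; split=> [|d f hf f0].
    by rewrite xE scaler_eq0 (negPf c0) (negPf (monomials_neq0 t0)).
  by rewrite xE (mevalZ_homog _ _ hf) f0 // mulr0.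
move=> T; rewrite finset.proper0 => T0 Tt; have [s sT] := not_tight_vertex T0 Tt.
exists (index_of (vertex s)) => //; rewrite /face index_ofK //.
exact: vertex_lattice_point.
Qed.

End Orbit.

Lemma K0class_iso (k : closedFieldType) (X Y : qpvar k) :
  qpiso X Y -> K0class X = K0class Y.
Proof. by move=> XY; apply: K0_eq; exact: K0iso. Qed.

Lemma cone_torus (k : fieldType) m (x : 'rV[k]_(1 + m)) :
  cone (torus_set k m) x <-> forall i, x 0 i != 0.
Proof.
split=> [[L [t [t0 Lt]] Lx] i|x0].
  have [c c0 ->] := hcoord_scale Lt Lx; rewrite !mxE mulf_neq0 //.
  by case: split => j; rewrite ?ord1 ?mxE ?oner_neq0.
have /pspace_of[L Lx] : x != 0 by apply/rV0Pn; exists (lshift m 0).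
exists L => //; pose c := (x 0 (lshift m 0))^-1.
have c0 : c != 0 by rewrite invr_eq0.
exists (rsubmx (c *: x)); split=> [i|]; first by rewrite !mxE mulf_neq0.
suff -> : row_mx 1 (rsubmx (c *: x)) = c *: x by exact: hcoordZ.
rewrite -[RHS]hsubmxK; congr row_mx; apply/rowP => i.
by rewrite !mxE !ord1 mulVf.
Qed.

Section OpenStratum.
Variables (R : realType) (k : closedFieldType) (m : nat).

Local Notation lattice := (permutohedron_lattice R m.+1).
Local Notation iv := (@index_of R m.+1 (vertex 1)).
Local Notation iw q := (@index_of R m.+1 (vertex (neighbour 1 q))).
Local Notation monomials := (@monomials k m.+1 m.+2 lattice).
Local Notation O := (QPVar (@stratum_lc R k m.+1 finset.set0)).

(** The chart at the identity vertex, multiplied by the [m]-th power of the coordinate there to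
    clear denominators. *)
Definition to_torus (i : 'I_(1 + m)) : {mpoly k[#|lattice|]} :=
  \prod_(q < m) (if (i <= q)%N then 'X_(iw q) else 'X_iv).

Definition of_torus (j : 'I_#|lattice|) : {mpoly k[1 + m]} :=
  \prod_(i < 1 + m) 'X_i ^+ enum_val j i.

Lemma polymap_to_torus (x : 'rV[k]_#|lattice|) : x 0 iv != 0 ->
  polymap to_torus x = x 0 iv ^+ m *: \row_i chart 1 x i.
Proof.
move=> xv; apply/rowP => i; rewrite !mxE rmorph_prod /chart perm1 /ratio_prod.
rewrite -[X in _ ^+ X](card_ord m) -prodr_const -big_split; apply: eq_bigr => q _ /=.
by case: ifP => _; rewrite mevalXU ?mulr1 // mulrCA divff ?mulr1.
Qed.

Lemma polymap_of_torus (y : 'rV[k]_(1 + m)) : polymap of_torus y = monomials (y 0).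
Proof.
apply/rowP => j; rewrite !mxE rmorph_prod; apply: eq_bigr => i _.
by rewrite rmorphXn /= mevalXU.
Qed.

Lemma open_stratum_coords (x : 'rV[k]_#|lattice|) : cone (qpset O) x ->
  [/\ cone (qpset (perm_variety R k m.+1)) x, x 0 iv != 0 & forall q, x 0 (iw q) != 0].
Proof.
move=> Ox; have /cone_stratum[/cone_face_set[Xx _] _] := Ox.
have /cone_open_stratum[c [t [c0 t0 xE]]] := Ox.
have x0 j : x 0 j != 0 by rewrite xE !mxE mulf_neq0 //; exact: monomial_neq0.
by split.
Qed.

Lemma open_stratum_torus : qpiso O (torus k m).
Proof.
apply: (@qpiso_polymap k O (torus k m) (\sum_(q < m) 1)%N (tri m.+1) to_torus of_torus).
- by move=> i; apply: homog_prod => q; case: ifP => _; exact: homog_mpolyX.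
- move=> j; have <- : (\sum_(i < 1 + m) enum_val j i)%N = tri m.+1.
    by rewrite (lattice_point_enum_val j).2 card_ord.
  apply: homog_prod => i; rewrite -[X in X.-homog]mul1n; apply: dhomogMn.
  exact: homog_mpolyX.
- move=> x /open_stratum_coords[Xx xv xw]; apply/cone_torus => i.
  rewrite polymap_to_torus // !mxE mulf_neq0 ?expf_neq0 //.
  by have [t0 _] := chartP Xx xv xw.
- move=> y /cone_torus y0; apply/cone_open_stratum; exists 1, (y 0); split=> //.
    exact: oner_neq0.
  by rewrite scale1r polymap_of_torus.
- move=> x /open_stratum_coords[Xx xv xw]; have [t0 [c c0 xE]] := chartP Xx xv xw.
  rewrite polymap_to_torus // polymap_of_torus.
  (* The scalar of [polymap_to_torus] is raised to the degree [tri m.+1] of [of_torus]; [c] comes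
     from [chartP]. *)
  exists ((x 0 iv ^+ m) ^+ tri m.+1 / c); first by rewrite mulf_neq0 ?invr_eq0 ?expf_neq0.
  have -> : (x 0 iv ^+ m *: \row_i chart 1 x i) 0 = (fun i => x 0 iv ^+ m * chart 1 x i).
    by apply/funext => i; rewrite !mxE.
  by rewrite monomialsZ [X in _ = _ *: X]xE scalerA divfK.
move=> y /cone_torus y0; set x := polymap of_torus y.
have xE : x = monomials (y 0) by exact: polymap_of_torus.
have x0 j : x 0 j != 0 by rewrite xE mxE; exact: monomial_neq0.
(* The chart returns [y] divided by its last coordinate. *)
exists (x 0 iv ^+ m / y 0 ord_max); first by rewrite mulf_neq0 ?invr_eq0 ?expf_neq0.
rewrite polymap_to_torus // -scalerA; congr (_ *: _); apply/rowP => i.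
rewrite !mxE mulrC -ratio_prod_telescope // /chart perm1; congr ratio_prod.
apply/funext => q; apply: (mulIf (x0 iv)); rewrite divfK //.
apply: (mulIf (y0 (hi q))); rewrite mulrAC divfK // [RHS]mulrC.
have := monomial_neighbour 1 (y 0) q; rewrite invg1 !perm1.
by rewrite xE !monomials_index //; exact: vertex_lattice_point.
Qed.

Lemma class_open_stratum :
  class (@stratum R k m.+1 finset.set0) = K0class (torus k m).
Proof. by rewrite -(K0class_iso open_stratum_torus) -classE. Qed.

End OpenStratum.

(** * Strata of the facets *)

Section Polynomials.
Variable k : fieldType.

Lemma homog_comp_linear N M (L : 'I_N -> {mpoly k[M]}) d (f : {mpoly k[N]}) :
  (forall i, L i \is 1.-homog) -> f \is d.-homog ->
  f \mPo [tuple L i | i < N] \is d.-homog.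
Proof.
move=> hL /dhomogP hf; rewrite comp_mpolyEX big_seq rpred_sum // => u uf.
rewrite rpredZ // -(hf u uf) /= mdegE comp_mpolyX; apply: homog_prod => i.
by rewrite tnth_mktuple -[X in X.-homog]mul1n; apply: dhomogMn.
Qed.

Lemma meval_comp_mktuple N M (L : 'I_N -> {mpoly k[M]}) (f : {mpoly k[N]})
    (x : 'rV[k]_M) :
  (f \mPo [tuple L i | i < N]).@[x 0] = f.@[polymap L x 0].
Proof.
by rewrite comp_mpoly_meval; apply: meval_eq => i; rewrite tnth_mktuple mxE.
Qed.

(** Along the orbit of a one-parameter subgroup [f] becomes a polynomial in [c], so the limit point
    [c = 0] can be reached. *)
Lemma meval_curve N (f : {mpoly k[N]}) (e : 'I_N -> nat) (z : 'I_N -> k) :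
  exists p : {poly k}, forall c, p.[c] = f.@[fun i => c ^+ e i * z i].
Proof.
exists (\sum_(u <- msupp f) (f@_u)%:P * \prod_i ('X^(e i) * (z i)%:P) ^+ u i) => c.
rewrite mevalE horner_sum; apply: eq_bigr => u _.
rewrite hornerM hornerC horner_prod; congr (_ * _); apply: eq_bigr => i _.
by rewrite horner_exp hornerM hornerXn hornerC.
Qed.

Lemma cone_segre N M (X : set (pspace k N)) (Y : set (pspace k M)) w :
  cone (segre_image X Y) w <->
  exists u v, [/\ cone X u, cone Y v & w = mxvec (u^T *m v)].
Proof.
split=> [[L [P [Q [u [v [XP YQ Pu Qv Luv]]]]] Lw]|[u [v [[P XP Pu] [Q YQ Qv] wE]]]].
  have [c c0 ->] := hcoord_scale Luv Lw; exists (c *: u), v; split.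
  - by apply: coneZ => //; exists P.
  - by exists Q.
  - by rewrite linearZ /= -scalemxAl linearZ.
have w0 : w != 0.
  have /rV0Pn[i ui] := hcoord_neq0 Pu; have /rV0Pn[j vj] := hcoord_neq0 Qv.
  apply/rV0Pn; exists (mxvec_index i j).
  by rewrite wE mxvecE mxE big_ord1 mxE mulf_neq0.
have [L Lw] := pspace_of w0; exists L => //.
by exists P, Q, u, v; split; rewrite -?wE.
Qed.

End Polynomials.

(** The product ['X * p] vanishes everywhere, while a nonzero polynomial over an algebraically
    closed field has a non-root. *)
Lemma poly_limit0 (k : closedFieldType) (p : {poly k}) :
  (forall c, c != 0 -> p.[c] = 0) -> p.[0] = 0.
Proof.
move=> p0; suff -> : p = 0 by rewrite horner0.
apply/eqP; have: 'X * p == 0.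
  apply/negPn/negP => /closed_nonrootP[c] /negP; apply; apply/rootP.
  by rewrite hornerM hornerX; have [->|/p0 ->] := eqVneq c 0; rewrite ?mul0r ?mulr0.
by rewrite mulf_eq0 polyX_eq0.
Qed.

(** * Lattice points of a facet as pairs of lattice points *)

Section Gluing.
Variables (n : nat) (S : {set 'I_n}) (x0 y0 : 'I_n).
Hypotheses (x0S : x0 \in S) (y0S : y0 \in ~: S).
Local Open Scope nat_scope.

(** The witnesses [x0] and [y0] only supply the defaults of [enum_rank_in], which are never reached
    here. *)
Definition glue (T : Type) (f : 'I_#|S| -> T) (g : 'I_#|~: S| -> T) (i : 'I_n) : T :=
  if i \in S then f (enum_rank_in x0S i) else g (enum_rank_in y0S i).

Lemma gluel T f g i : @glue T f g (enum_val i) = f i.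
Proof. by rewrite /glue enum_valP enum_valK_in. Qed.

Lemma gluer T f g i : @glue T f g (enum_val i) = g i.
Proof.
by rewrite /glue; have := enum_valP i; rewrite inE => /negPf ->; rewrite enum_valK_in.
Qed.

Lemma split_ord (P : 'I_n -> Prop) :
  (forall i : 'I_#|S|, P (enum_val i)) -> (forall i : 'I_#|~: S|, P (enum_val i)) ->
  forall i, P i.
Proof.
move=> Pl Pr i; have [iS|iS] := boolP (i \in S).
  by rewrite -(enum_rankK_in x0S iS).
have {}iS : i \in ~: S by rewrite inE.
by rewrite -(enum_rankK_in y0S iS).
Qed.

Definition glue_point (b : {ffun 'I_#|S| -> 'I_#|S|.+1})
    (c : {ffun 'I_#|~: S| -> 'I_#|~: S|.+1}) : {ffun 'I_n -> 'I_n.+1} :=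
  [ffun i => inord (glue (fun j => b j : nat) (fun j => c j + #|S|) i)].

Definition restrl (a : {ffun 'I_n -> 'I_n.+1}) : {ffun 'I_#|S| -> 'I_#|S|.+1} :=
  [ffun i => inord (a (enum_val i))].

Definition restrr (a : {ffun 'I_n -> 'I_n.+1}) : {ffun 'I_#|~: S| -> 'I_#|~: S|.+1} :=
  [ffun i => inord (a (enum_val i) - #|S|)].

Lemma glue_pointE b c i :
  glue_point b c i = glue (fun j => b j : nat) (fun j => c j + #|S|) i :> nat.
Proof.
rewrite ffunE inordK // ltnS.
have Sn : #|S| + #|~: S| = n by rewrite cardsC card_ord.
elim/split_ord: i => i; rewrite ?gluel ?gluer.
  by have := ltn_ord (b i); lia.
by have := ltn_ord (c i); lia.
Qed.

Lemma glue_point_lattice b c : lattice_point b -> lattice_point c ->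
  lattice_point (glue_point b c) /\ tight S (fun i => glue_point b c i : nat).
Proof.
move=> bP cP; apply: (glue_permutohedral bP cP) => j.
  by rewrite glue_pointE gluel.
by rewrite glue_pointE gluer.
Qed.

Section Restrict.
Variables (a : {ffun 'I_n -> 'I_n.+1}) (aP : lattice_point a).
Hypothesis aS : tight S (fun i => a i : nat).

Lemma restrlE i : restrl a i = a (enum_val i) :> nat.
Proof.
rewrite ffunE inordK // ltnS.
by have := permutohedral_le (restrictl_permutohedral aP aS) i; rewrite card_ord.
Qed.

Lemma restrrE i : restrr a i = a (enum_val i) - #|S| :> nat.
Proof.
rewrite ffunE inordK // ltnS.
by have := permutohedral_le (restrictr_permutohedral aP aS) i; rewrite card_ord.
Qed.

Lemma restrl_lattice : lattice_point (restrl a).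
Proof.
rewrite /lattice_point (_ : (fun i => _) = fun j => a (enum_val j) : nat).
  exact: restrictl_permutohedral aP aS.
by apply/funext => i; rewrite restrlE.
Qed.

Lemma restrr_lattice : lattice_point (restrr a).
Proof.
rewrite /lattice_point (_ : (fun i => _) = fun j => a (enum_val j) - #|S|).
  exact: restrictr_permutohedral aP aS.
by apply/funext => i; rewrite restrrE.
Qed.

Lemma glue_restr : glue_point (restrl a) (restrr a) = a.
Proof.
apply/ffunP; elim/split_ord => i; apply: ord_inj; rewrite glue_pointE ?gluel ?gluer.
  exact: restrlE.
rewrite restrrE subnK // ltnW //; apply: (tight_le aP aS).
by have := enum_valP i; rewrite inE.
Qed.

End Restrict.

Lemma restrl_glue b c : restrl (glue_point b c) = b.
Proof.
by apply/ffunP => i; apply: ord_inj; rewrite ffunE glue_pointE gluel inordK.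
Qed.

Lemma restrr_glue b c : restrr (glue_point b c) = c.
Proof.
by apply/ffunP => i; apply: ord_inj; rewrite ffunE glue_pointE gluer addnK inordK.
Qed.

End Gluing.

(** * The stratum of a facet as a Segre product *)

Section StratumProduct.
Variables (R : realType) (k : closedFieldType).
Variables (n : nat) (S : {set 'I_n}) (x0 y0 : 'I_n).
Hypotheses (x0S : x0 \in S) (y0S : y0 \in ~: S).

Local Notation lattice n := (permutohedron_lattice R n).
Local Notation idx n := 'I_#|lattice n|.
Local Notation perm_variety n := (perm_variety R k n).
Local Notation open_stratum n := (@stratum R k n finset.set0).
Local Notation monomials n := (@monomials k n n.+1 (lattice n)).
Local Notation NL := #|lattice #|S| |.
Local Notation NR := #|lattice #|~: S| |.

Definition glue_idx (i : 'I_NL) (j : 'I_NR) : idx n :=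
  @index_of R n (glue_point x0S y0S (enum_val i) (enum_val j)).

Definition idxl (l : idx n) : 'I_NL := @index_of R _ (restrl S (enum_val l)).
Definition idxr (l : idx n) : 'I_NR := @index_of R _ (restrr S (enum_val l)).

Lemma glue_idx_val i j :
  enum_val (glue_idx i j) = glue_point x0S y0S (enum_val i) (enum_val j).
Proof.
rewrite index_ofK //.
by have [] := glue_point_lattice x0S y0S (lattice_point_enum_val i)
  (lattice_point_enum_val j).
Qed.

Lemma face_glue i j : face S (glue_idx i j).
Proof.
rewrite /face glue_idx_val.
by have [] := glue_point_lattice x0S y0S (lattice_point_enum_val i)
  (lattice_point_enum_val j).
Qed.

Lemma idxl_glue i j : idxl (glue_idx i j) = i.
Proof. by rewrite /idxl glue_idx_val restrl_glue enum_valK_index. Qed.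

Lemma idxr_glue i j : idxr (glue_idx i j) = j.
Proof. by rewrite /idxr glue_idx_val restrr_glue enum_valK_index. Qed.

Lemma glue_idxK l : face S l -> glue_idx (idxl l) (idxr l) = l.
Proof.
move=> lS; have lP := lattice_point_enum_val l; rewrite /glue_idx /idxl /idxr.
rewrite !index_ofK ?glue_restr ?enum_valK_index //.
  exact: restrr_lattice lP lS.
exact: restrl_lattice lP lS.
Qed.

Lemma face_glue_trace (T : {set 'I_n}) i j : S \subset T ->
  face T (glue_idx i j) = face (trace (~: S) T) j.
Proof.
have lP := lattice_point_enum_val (glue_idx i j); have lS := face_glue i j.
move=> ST; rewrite /face (tight_trace lP lS ST) -{2}(idxr_glue i j).
congr tight; apply/funext => q.
by rewrite (index_ofK _ (restrr_lattice lP lS)) (restrrE lP lS).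
Qed.

(** The shift by [#|S|] yields a factor independent of [i] and [j], hence invisible projectively. *)
Lemma monomial_glue i j (t : 'I_n -> k) :
  monomial (enum_val (glue_idx i j)) t =
  (\prod_(q in ~: S) t q ^+ #|S|) *
  (monomial (enum_val i) (fun q => t (enum_val q)) *
   monomial (enum_val j) (fun q => t (enum_val q))).
Proof.
rewrite /monomial (bigID (mem S)) /= mulrCA; congr (_ * _).
  rewrite big_enum_val; apply: eq_bigr => q _.
  by rewrite glue_idx_val glue_pointE gluel.
rewrite (eq_bigl (mem (~: S))) => [|q]; last by rewrite /= inE.
rewrite [LHS]big_enum_val [X in _ = X * _]big_enum_val -big_split; apply: eq_bigr => q _ /=.
by rewrite glue_idx_val glue_pointE gluer -exprD addnC.
Qed.

(** The Segre coordinates of the pair, placed on the facet and extended by zero. *)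
Definition pad (u : 'rV[k]_NL) (v : 'rV[k]_NR) : 'rV[k]_#|lattice n| :=
  \row_l (if face S l then u 0 (idxl l) * v 0 (idxr l) else 0).

Lemma pad_glue u v i j : pad u v 0 (glue_idx i j) = u 0 i * v 0 j.
Proof. by rewrite mxE face_glue idxl_glue idxr_glue. Qed.

(* Scaling the coordinates in [S] by [c] and letting [c] tend to 0 degenerates
   torus points to torus points of the face. *)
Lemma pad_torus d (f : {mpoly k[#|lattice n|]}) tl tr :
  f \is d.-homog -> (forall t, (forall i, t i != 0) -> f.@[monomials n t 0] = 0) ->
  (forall i, tl i != 0) -> (forall i, tr i != 0) ->
  f.@[pad (monomials _ tl) (monomials _ tr) 0] = 0.
Proof.
move=> hf f0 tl0 tr0; pose t := glue x0S y0S tl tr.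
have t0 i : t i != 0 by elim/(split_ord x0S y0S): i => i; rewrite /t ?gluel ?gluer.
pose K := \prod_(q in ~: S) t q ^+ #|S|.
have K0 : K != 0 by apply/prodf_neq0 => q _; rewrite expf_neq0.
(* The excess of [l] over Rado's bound for [S], zero exactly on the facet: the power of [c] left at
   [l] after a common factor [c ^+ tri #|S|] is removed. *)
pose e (l : idx n) := (\sum_(i in S) enum_val l i - tri #|S|)%N.
have [p pE] := meval_curve f e (monomials n t 0).
have pc c : c != 0 -> p.[c] = 0.
  move=> c0; pose tc i := if i \in S then c * t i else t i.
  have tc0 i : tc i != 0 by rewrite /tc; case: ifP; rewrite ?mulf_neq0.
  apply: (mulfI (expf_neq0 d (expf_neq0 (tri #|S|) c0))); rewrite mulr0 pE.
  rewrite -(homog_meval _ _ hf) -(f0 tc tc0); apply: meval_eq => l.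
  rewrite !mxE mulrA -exprD subnKC; last first.
    exact: (lattice_point_enum_val l).1.
  rewrite /monomial [X in _ * X](bigID (mem S)) [RHS](bigID (mem S)) /= mulrA; congr (_ * _).
    rewrite -prodrXr -big_split; apply: eq_bigr => i iS /=.
    by rewrite /tc iS exprMn.
  by apply: eq_bigr => i /negPf iS; rewrite /tc iS.
have /eqP := poly_limit0 pc; rewrite pE.
(* At [c = 0] the power [0 ^+ e l] is 1 on the facet and 0 off it; [K] is the common factor of
   [monomial_glue]. *)
have -> : f.@[fun l => 0 ^+ e l * monomials n t 0 l] =
    K ^+ d * f.@[pad (monomials _ tl) (monomials _ tr) 0].
  rewrite -(homog_meval _ _ hf); apply: meval_eq => l.
  rewrite mxE [in RHS]mxE expr0n.
  have eE : (e l == 0%N) = face S l.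
    rewrite /face /tight /e subn_eq0 eqn_leq.
    by rewrite (lattice_point_enum_val l).1 andbT.
  rewrite eE; case: ifP => lS; last by rewrite mul0r mulr0.
  rewrite mul1r -{1}(glue_idxK lS) monomial_glue; congr (_ * (_ * _)); rewrite mxE.
    by congr monomial; apply/funext => q; rewrite /t gluel.
  by congr monomial; apply/funext => q; rewrite /t gluer.
by rewrite mulf_eq0 expf_eq0 (negPf K0) andbF => /eqP.
Qed.

(** As [pad] is linear in each argument, [pad_torus] extends to the closures one factor at a time:
    first to all [u] with a torus point on the right, then to all [v] with [u] fixed. *)
Lemma pad_cone u v : cone (qpset (perm_variety #|S|)) u ->
  cone (qpset (perm_variety #|~: S|)) v -> cone (qpset (perm_variety n)) (pad u v).
Proof.
move=> /cone_toric[u0 uX] /cone_toric[v0 vX]; apply/cone_toric; split.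
  have /rV0Pn[i ui] := u0; have /rV0Pn[j vj] := v0.
  by apply/rV0Pn; exists (glue_idx i j); rewrite pad_glue mulf_neq0.
move=> d f hf f0.
have linZ N (c : k) (i : 'I_N) b : (if b then c *: 'X_i else 0) \is [in k[N], 1.-homog].
  by case: b; rewrite ?rpred0 // rpredZ // homog_mpolyX.
have fu tr : (forall i, tr i != 0) -> f.@[pad u (monomials _ tr) 0] = 0.
  move=> tr0.
  pose L l : {mpoly k[NL]} :=
    if face S l then monomials _ tr 0 (idxr l) *: 'X_(idxl l) else 0.
  have padL w : pad w (monomials _ tr) = polymap L w.
    apply/rowP => l; rewrite !mxE /L; case: ifP => _; last by rewrite meval0.
    by rewrite mevalZ mevalXU mulrC mxE.
  rewrite padL -meval_comp_mktuple; apply: (uX d) => [|tl tl0].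
    by apply: homog_comp_linear => // l; exact: linZ.
  by rewrite meval_comp_mktuple -padL; exact: pad_torus hf f0 tl0 tr0.
pose L l : {mpoly k[NR]} := if face S l then u 0 (idxl l) *: 'X_(idxr l) else 0.
have padL w : pad u w = polymap L w.
  apply/rowP => l; rewrite !mxE /L; case: ifP => _; last by rewrite meval0.
  by rewrite mevalZ mevalXU.
rewrite padL -meval_comp_mktuple; apply: (vX d) => [|tr tr0].
  by apply: homog_comp_linear => // l; exact: linZ.
by rewrite meval_comp_mktuple -padL; exact: fu.
Qed.

Lemma pad_stratum u v : cone (qpset (perm_variety #|S|)) u ->
  cone (open_stratum #|~: S|) v -> cone (stratum S) (pad u v).
Proof.
move=> Xu /cone_stratum[/cone_face_set[Xv _] vT]; apply/cone_stratum; split.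
  apply/cone_face_set; split=> [|l lS]; first exact: pad_cone.
  by rewrite mxE (negPf lS).
have /rV0Pn[i ui] := cone_neq0 Xu.
move=> T /fintype.properP[ST [y yT yS]] Tt; have {}yS : y \in ~: S by rewrite inE.
have [||j jT vj] := vT (trace (~: S) T).
- rewrite finset.proper0; apply/set0Pn; exists (enum_rank_in yS y).
  by rewrite inE enum_rankK_in.
- apply: contra Tt => /eqP tT; apply/eqP/setP => x; rewrite inE.
  have [xS|xS] := boolP (x \in S); first exact: fintype.subsetP xS.
  have {}xS : x \in ~: S by rewrite inE.
  have := finset.in_setT (enum_rank_in xS x); rewrite -tT inE.
  by rewrite enum_rankK_in.
exists (glue_idx i j); first by rewrite face_glue_trace.
by rewrite pad_glue mulf_neq0.
Qed.

(** On the facet [x] is a matrix of rank one: the column and the row through a nonzero entry, one of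
    them rescaled, give the two factors. *)
Lemma stratum_pad x : cone (stratum S) x ->
  exists u v, [/\ cone (qpset (perm_variety #|S|)) u,
                  cone (open_stratum #|~: S|) v & x = pad u v].
Proof.
move=> /cone_stratum[/cone_face_set[Xx xF] xT].
have xface l : x 0 l != 0 -> face S l.
  by move=> xl; apply/negPn/negP => lS; rewrite xF ?eqxx in xl.
have /rV0Pn[l xl] := cone_neq0 Xx.
pose i0 := idxl l; pose j0 := idxr l.
have {}xl : x 0 (glue_idx i0 j0) != 0 by rewrite glue_idxK ?xface.
have minors i j : x 0 (glue_idx i j) * x 0 (glue_idx i0 j0) =
                  x 0 (glue_idx i j0) * x 0 (glue_idx i0 j).
  have eX (a b : idx n) (y : 'rV[k]__) : ('X_a * 'X_b).@[y 0] = y 0 a * y 0 b.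
    by rewrite mevalM !mevalXU.
  rewrite -!eX; apply: (toric_eq (d := 1 + 1)) Xx; try by rewrite dhomogM ?homog_mpolyX.
  by move=> t t0; rewrite !eX !mxE !monomial_glue; ring.
(* A slice of [x] along [h] with a nonzero entry lies in the smaller variety, because the slices of
   torus points are multiples of torus points. *)
have sub_toric q (h : 'I_#|lattice q| -> idx n) (phi : ('I_n -> k) -> 'I_q -> k)
    (c : ('I_n -> k) -> k) j :
    (forall t, (forall i, t i != 0) -> (forall i, phi t i != 0) /\
       forall j, monomials n t 0 (h j) = c t * monomials q (phi t) 0 j) ->
    x 0 (h j) != 0 -> cone (qpset (perm_variety q)) (\row_j x 0 (h j)).
  move=> hphi xj; apply/cone_toric; split=> [|d g hg g0].
    by apply/rV0Pn; exists j; rewrite mxE.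
  rewrite (@meval_eq _ _ _ (fun j => x 0 (h j))) => [|j']; last by rewrite mxE.
  rewrite -meval_comp; have /cone_toric[_] := Xx; apply; first exact: homog_comp hg.
  move=> t t0; have [phi0 mE] := hphi t t0.
  by rewrite meval_comp (meval_eq _ mE) (homog_meval _ _ hg) g0 // mulr0.
pose u : 'rV[k]_NL := \row_i x 0 (glue_idx i j0).
pose v : 'rV[k]_NR := \row_j x 0 (glue_idx i0 j).
have Xu : cone (qpset (perm_variety #|S|)) u.
  apply: (sub_toric _ _ (fun t q => t (enum_val q)) (fun t =>
    (\prod_(q in ~: S) t q ^+ #|S|) *
    monomial (enum_val j0) (fun q => t (enum_val q))) i0) => // t t0; split=> // j.
  by rewrite !mxE monomial_glue; ring.
have Xv : cone (qpset (perm_variety #|~: S|)) v.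
  apply: (sub_toric _ _ (fun t q => t (enum_val q)) (fun t =>
    (\prod_(q in ~: S) t q ^+ #|S|) *
    monomial (enum_val i0) (fun q => t (enum_val q))) j0) => // t t0; split=> // j.
  by rewrite !mxE monomial_glue; ring.
pose c := x 0 (glue_idx i0 j0).
have xE : x = pad u (c^-1 *: v).
  apply/rowP => l'; have [lS|lS] := boolP (face S l'); last first.
    by rewrite xF // mxE (negPf lS).
  rewrite -(glue_idxK lS) pad_glue !mxE; apply: (mulIf xl).
  by rewrite minors mulrCA -/c -[RHS]mulrA [_ * c]mulrC [RHS]mulrA; field.
exists u, (c^-1 *: v); split=> //; apply: coneZ; first by rewrite invr_eq0.
apply/cone_stratum; split.
  by apply/cone_face_set; split=> // j; rewrite face0.
move=> T; rewrite finset.proper0 => T0 Tt.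
have dS : fintype.disjoint (mem (~: S)) (mem S)
  by rewrite finset.disjoints_subset fintype.subxx.
have trT : trace (~: S) (S :|: enum_val @: T) = T by rewrite trace_imset.
(* A facet [T] of the complement corresponds to the larger face given by [S] together with [T]. *)
have [||l' lT xl'] := xT (S :|: enum_val @: T).
- rewrite finset.properEneq finset.subsetUl andbT; apply: contraNneq T0 => TS.
  by rewrite -trT -TS traceC.
- by apply: contra Tt => /eqP TS; rewrite -trT TS trace_set // finset.subsetT.
have lS := xface _ xl'; rewrite -(glue_idxK lS) in lT xl'.
exists (idxr l'); first by rewrite face_glue_trace ?trT ?finset.subsetUl in lT.
by rewrite mxE; apply: contraNneq xl' => v0; rewrite xE pad_glue !mxE v0 mulr0 mulr0.
Qed.

Local Notation Z := (QPVar (@stratum_lc R k n S)).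
Local Notation W := (qpprod (perm_variety #|S|)
                            (QPVar (@stratum_lc R k #|~: S| finset.set0))).

Definition to_segre (w : 'I_(NL * NR)) : {mpoly k[#|lattice n|]} :=
  mxvec (\matrix_(i, j) 'X_(glue_idx i j)) 0 w.

Definition of_segre (l : idx n) : {mpoly k[NL * NR]} :=
  if face S l then 'X_(mxvec_index (idxl l) (idxr l)) else 0.

Lemma polymap_to_segre u v : polymap to_segre (pad u v) = mxvec (u^T *m v).
Proof.
apply/rowP => w; case/mxvec_indexP: w => i j.
by rewrite mxE /to_segre !mxvecE !mxE mevalXU pad_glue big_ord1 mxE.
Qed.

Lemma polymap_of_segre u v : polymap of_segre (mxvec (u^T *m v)) = pad u v.
Proof.
apply/rowP => l; rewrite !mxE /of_segre; case: ifP => _; last by rewrite meval0.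
by rewrite mevalXU mxvecE mxE big_ord1 mxE.
Qed.

Lemma stratum_segre : qpiso Z W.
Proof.
apply: (@qpiso_polymap k Z W 1 1 to_segre of_segre).
- move=> w; case/mxvec_indexP: w => i j.
  by rewrite /to_segre mxvecE mxE homog_mpolyX.
- by move=> l; rewrite /of_segre; case: ifP => _; rewrite ?homog_mpolyX ?rpred0.
- move=> x /stratum_pad[u [v [Xu Xv ->]]]; rewrite polymap_to_segre.
  by apply/cone_segre; exists u, v.
- move=> w /cone_segre[u [v [Xu Xv ->]]]; rewrite polymap_of_segre.
  exact: pad_stratum.
- move=> x /stratum_pad[u [v [_ _ ->]]]; exists 1; first exact: oner_neq0.
  by rewrite polymap_to_segre polymap_of_segre scale1r.
move=> w /cone_segre[u [v [_ _ ->]]]; exists 1; first exact: oner_neq0.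
by rewrite polymap_of_segre polymap_to_segre scale1r.
Qed.

End StratumProduct.

(** * The recurrence *)

Lemma K0class_prod (k : closedFieldType) (X Y : qpvar k) :
  K0class (qpprod X Y) = K0class X * K0class Y.
Proof. by rewrite -[RHS]/(K0_mul _ _) K0_mulE; apply/esym/K0_eq/K0prod. Qed.

Lemma class_stratum (R : realType) (k : closedFieldType) n (S : {set 'I_n}) :
  S != finset.set0 -> S != [set: 'I_n]%SET ->
  class (@stratum R k n S) =
  K0class (perm_variety R k #|S|) * K0class (torus k (n - #|S|).-1).
Proof.
move=> S0 ST; have /set0Pn[x0 x0S] := S0.
have [y0 y0S] : exists y, y \in ~: S.
  by apply/set0Pn; apply: contraNneq ST => SC; rewrite -(finset.setCK S) SC finset.setC0.
rewrite (classE (QPVar (@stratum_lc R k n S))) (K0class_iso (stratum_segre R k x0S y0S)).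
rewrite K0class_prod; congr (_ * _).
have -> : (n - #|S|)%N = #|~: S|.
  by have := cardsC S; rewrite card_ord => Sn; rewrite -[X in (X - _)%N]Sn addKn.
have : (0 < #|~: S|)%N by rewrite card_gt0; apply/set0Pn; exists y0.
(* A complement with [b.+1] elements gives the torus of dimension [b]. *)
by case: #|~: S| => // b _; rewrite -(class_open_stratum R) -classE.
Qed.

Lemma sum_proper_subsets (V : nmodType) m (F : nat -> V) :
  \sum_(S : {set 'I_m.+1} | S != [set: 'I_m.+1]%SET) F #|S| =
  \sum_(i < m.+1) F i *+ 'C(m.+1, i).
Proof.
have ltS (S : {set 'I_m.+1}) : (S != [set: 'I_m.+1]%SET) = (#|S| < m.+1)%N.
  rewrite -[X in (_ < X)%N](card_ord m.+1) ltn_neqAle max_card andbT.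
  congr negb; apply/eqP/eqP => [->|cS]; first by rewrite cardsT.
  by apply/eqP; rewrite eqEcard finset.subsetT cardsT cS /=.
rewrite (partition_big (fun S : {set 'I_m.+1} => inord #|S| : 'I_m.+1) xpredT) //=.
apply: eq_bigr => i _; rewrite -[X in 'C(X, _)](card_ord m.+1) -card_draws -sumr_const.
apply: eq_big => [S|S]; last by move=> /andP[ST /eqP <-]; rewrite inordK -?ltS.
rewrite inE ltS; apply/andP/eqP => [[Sm /eqP <-]|Si]; first by rewrite inordK.
by rewrite Si; split; [exact: ltn_ord | apply/eqP/val_inj; rewrite /= inordK].
Qed.

Lemma permutohedral_recurrence (R : realType) m :
  pi_egf R m.+1 = \sum_(i < m.+1)
    (pi_egf R i * K0class (torus R[i] (m.+1 - i).-1)) *+ 'C(m.+1, i).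
Proof.
rewrite -(sum_proper_subsets _ (fun i => pi_egf R i * K0class (torus R[i] (m.+1 - i).-1))).
rewrite /= -[LHS]/(K0class (perm_variety R R[i] m.+1)) class_strata //.
apply: eq_bigr => S ST; have [->|S0] := eqVneq S finset.set0.
  (* The convention [pi_egf R 0 = 1] makes the open stratum fit the general product formula. *)
  by rewrite cards0 mul1r class_open_stratum.
rewrite class_stratum //; congr (_ * _).
by move: S0; rewrite -card_gt0; case: #|S|.
Qed.

Lemma pi_tau_inverse (R : realType) :
  egf_mul (pi_egf R) (tau_egf R) = series_one (K0 R[i]).
Proof.
apply/funext => -[|m]; rewrite /egf_mul /series_one.
  by rewrite big_ord1 /= mul1r.
(* The last term, with [tau_egf R 0 = 1], is the left side of the recurrence; each of the others
   cancels a term of its right side. *)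
rewrite big_ord_recr /= subnn mulr1 binn mulr1n -[K0class _]/(pi_egf R m.+1).
rewrite permutohedral_recurrence -big_split big1 //= => i _.
by rewrite subSn -1?ltnS //= mulrN mulNrn addNr.
Qed.

(* The first identity is pi(x) tau(x) = 1 for series in x^n/n! with
   coefficients in K_0; the second one is the identity of ordinary power
   series after extension of scalars to any commutative rational algebra,
   such as the tensor product of K_0 with the rationals. *)
Theorem theorem5p1 (R : realType) :
  egf_mul (pi_egf R) (tau_egf R) = series_one (K0 R[i]) /\
  (forall (B : comAlgType rat) (phi : {rmorphism K0 R[i] -> B}),
     series_mul (egf_series phi (pi_egf R)) (egf_series phi (tau_egf R)) =
     series_one B).
Proof.
split=> [|B phi]; first exact: pi_tau_inverse.
apply/funext => n; rewrite /series_mul /egf_series.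
transitivity ((n`!%:R : rat)^-1 *: phi (egf_mul (pi_egf R) (tau_egf R) n)).
  rewrite /egf_mul rmorph_sum scaler_sumr; apply: eq_bigr => i _.
  rewrite rmorphMn rmorphM /= -scalerAl -scalerAr scalerA -scaler_nat scalerA.
  congr (_ *: _); have in_ : (i <= n)%N by rewrite -ltnS.
  (* The coefficients agree since [n! = 'C(n, i) * i! * (n - i)!]. *)
  rewrite -(bin_fact in_) !natrM; field.
  by rewrite !pnatr_eq0 -!lt0n !fact_gt0 bin_gt0.
rewrite pi_tau_inverse /series_one; case: n => [|n] /=.
  by rewrite fact0 invr1 rmorph1 scale1r.
by rewrite rmorph0 scaler0.
Qed.
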